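(* Let $n\in\{5,6,7\}$ and $k=n-5$. A vertex-figure split, at any vertex, of a $k_{21}$ facet of the contact polytope of the lattice kissing configuration in dimension $n$ (the rectified $5$-cell $0_{21}$ for $D_5$, the $5$-demicube $1_{21}$ for $E_6$, the Gosset polytope $2_{21}$ for $E_7$) folds through $2\beta$ with $\sin\beta=\dfrac1{10-n}$, and the two apexes of the reflex ridge it creates (obtained by joining two pyramids along the vertex figure) have inner product $\dfrac{1}{10-n}$.
   Context: The lattice kissing configurations $D_5,E_6,E_7$ are the sets of roots of the root systems $D_5,E_6,E_7$ scaled to lie on the unit sphere $\mathbb{S}^{n-1}$ centered at the origin $o$; the contact polytope is the convex hull of the configuration. The contact polytope of $D_5$ is the rectified $5$-orthoplex, whose facets are $16$-cells and rectified $5$-cells $0_{21}$; that of $E_6$ is $1_{22}$, whose facets are $5$-demicubes $1_{21}$; that of $E_7$ is $2_{31}$, whose facets are $6$-simplices and Gosset polytopes $2_{21}$. All edges have length $1$. The vertex figure of a vertex $v$ of a facet $F$ is the convex hull $G$ of the vertices of $F$ joined to $v$ by an edge. The vertex-figure split of $F$ at $v$ divides $F$ along the hyperplane (of $\operatorname{aff}(F)$) through $G$ into the pyramid with apex $v$ over $G$ and the diminished cell, which is the rest of $F$. Two pieces of the same kind (two pyramids, or two diminished cells) are joined along $G$ when the second is a distinct copy of the first, inscribed in the same unit sphere, sharing $G$ with it, and obtained from it by a congruence that is the identity on $G$. The split folds through $2\beta$ ($0\le\beta<\pi/2$) when the affine hulls of two pieces of the same kind joined along $G$ differ by a turn about $\operatorname{aff}(G)$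 through the angle $2\beta$, i.e. the dihedral angle along $G$ differs from $\pi$ by $2\beta$. Joining two pyramids gives a reflex ridge; its two apexes are $v$ and the apex $v'$ of the second pyramid. *)

(* Defs.v *)
From HB Require Import structures.
From mathcomp Require Import all_boot all_order all_algebra.
From mathcomp Require Import all_classical all_reals all_analysis.

Set Implicit Arguments.
Unset Strict Implicit.
Unset Printing Implicit Defensive.

Import Order.TTheory GRing.Theory Num.Theory.
Import numFieldNormedType.Exports.

Local Open Scope classical_set_scope.
Local Open Scope ring_scope.

(* Points of R^n are row vectors.  The library norm on 'rV[R]_n is the sup norm,
   so Euclidean lengths are expressed with the inner product [dot]. *)

Section Euclidean.
Context {R : realType} {n : nat}.
Implicit Types (x y a b p : 'rV[R]_n) (A : set 'rV[R]_n) (f : 'rV[R]_n -> 'rV[R]_n).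

Definition dot x y : R := (x *m y^T) 0 0.

Definition euclid_norm x : R := Num.sqrt (dot x x).

Definition isometry f : Prop :=
  forall x y, euclid_norm (f x - f y) = euclid_norm (x - y).

(* Orthogonal reflection in the hyperplane through 0 normal to a. *)
Definition refl a x : 'rV[R]_n := x - (2 * dot x a / dot a a) *: a.

Definition conv_hull A : set 'rV[R]_n := smallest (@convex_set R 'rV[R]_n) A.

Definition aff_hull A : set 'rV[R]_n :=
  [set x | exists (m : nat) (p : 'I_m -> 'rV[R]_n) (c : 'I_m -> R),
     [/\ forall i, A (p i), \sum_i c i = 1 & x = \sum_i c i *: p i]].

Definition has_dim A (d : nat) : Prop :=
  exists (p : 'rV[R]_n) (B : 'M[R]_(d, n)),
    row_free B /\ aff_hull A = [set p + t *m B | t in [set: 'rV[R]_d]].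

(* f is a turn through the angle theta about aff A, where aff A has
   codimension 2 and (a, b) is an orthonormal basis of the plane normal to it. *)
Definition turn_about A (theta : R) f : Prop :=
  has_dim A n.-2 /\
  exists p a b,
    [/\ A p,
        [/\ dot a a = 1, dot b b = 1 & dot a b = 0],
        (forall x, A x -> dot a (x - p) = 0 /\ dot b (x - p) = 0)
      & forall x,
          f x = x + ((cos theta - 1) * dot a (x - p) - sin theta * dot b (x - p)) *: a
                  + (sin theta * dot a (x - p) + (cos theta - 1) * dot b (x - p)) *: b].

End Euclidean.

Section Polytopes.
Context {R : realType} {n : nat}.
Implicit Types (P F G Q : set 'rV[R]_n) (v w : 'rV[R]_n).

Definition face P F : Prop :=
  exists (a : 'rV[R]_n) (c : R),
    (forall x, P x -> dot a x <= c) /\ F = [set x | P x /\ dot a x = c].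

(* P is meant to be full-dimensional in R^n. *)
Definition facet P F : Prop := face P F /\ has_dim F n.-1.

Definition vertex P v : Prop := face P [set v].

Definition joined_by_edge P v w : Prop :=
  [/\ v <> w, vertex P v, vertex P w & face P (conv_hull [set v; w])].

Definition inscribed Q : Prop := forall x, vertex Q x -> dot x x = 1.

Definition vertex_figure F v : set 'rV[R]_n :=
  conv_hull [set w | joined_by_edge F v w].

Definition pyramid v G : set 'rV[R]_n := conv_hull (v |` G).

(* The rest of F, taken together with the cut G. *)
Definition diminished_cell F v : set 'rV[R]_n :=
  let G := vertex_figure F v in (F `\` pyramid v G) `|` G.

(* Q' is a second copy of the piece Q, joined to it along G. *)
Definition joined_along G Q Q' : Prop :=
  [/\ Q' <> Q,
      inscribed Q /\ inscribed Q',
      G `<=` Q `&` Q'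
    & exists f : 'rV[R]_n -> 'rV[R]_n,
        [/\ isometry f, f @` Q = Q' & forall x, G x -> f x = x]].

(* w is the unit vector parallel to aff Q, normal to aff G, pointing from G
   into Q; it is unique when aff G is a hyperplane of aff Q. *)
Definition inner_conormal G Q (w : 'rV[R]_n) : Prop :=
  [/\ dot w w = 1,
      (forall g, G g -> aff_hull Q (g + w)),
      (forall g g', G g -> G g' -> dot w (g - g') = 0)
    & forall x g, Q x -> G g -> 0 <= dot w (x - g)].

(* The dihedral angle is measured in [0, pi]; it and its explement
   2 * pi - delta differ from pi by the same amount. *)
Definition dihedral_angle G Q Q' (delta : R) : Prop :=
  exists w w' : 'rV[R]_n,
    [/\ inner_conormal G Q w, inner_conormal G Q' w' & delta = acos (dot w w')].

(* Hyperplanes are unoriented, so a turn carrying aff Q to aff Q' only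
   determines theta up to theta |-> pi - theta; the dihedral angle fixes it. *)
Definition differ_by_turn G Q Q' (theta : R) : Prop :=
  (exists f, turn_about (aff_hull G) theta f /\ aff_hull Q' = f @` aff_hull Q) /\
  (exists delta, dihedral_angle G Q Q' delta /\ `|delta - pi| = theta).

Definition piece_folds G Q (theta : R) : Prop :=
  (exists Q', joined_along G Q Q') /\
  (forall Q', joined_along G Q Q' -> differ_by_turn G Q Q' theta).

Definition split_folds F v (theta : R) : Prop :=
  let G := vertex_figure F v in
  piece_folds G (pyramid v G) theta /\ piece_folds G (diminished_cell F v) theta.

(* Two pyramids over the vertex figure of F at v, with apexes v and v'. *)
Definition reflex_ridge F v v' : Prop :=
  let G := vertex_figure F v in joined_along G (pyramid v G) (pyramid v' G).

End Polytopes.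

(* The diagram E_m on the nodes 0, ..., m-1: a path 0 - 1 - ... - (m-2), with
   the node m-1 attached to the node 2.  E_4 = A_4, E_5 = D_5, and E_6, E_7
   are the exceptional diagrams. *)
Definition E_adj (m : nat) (i j : 'I_m) : bool :=
  let arc (a b : nat) :=
    ((a.+1 == b) && (b < m.-1)%N) || ((a == 2) && (b == m.-1)) in
  arc i j || arc j i.

Definition E_cartan (R : realType) (m : nat) (i j : 'I_m) : R :=
  if i == j then 2 else if E_adj i j then -1 else 0.

Section RootSystems.
Context {R : realType} {n : nat}.
Implicit Types (Phi : set 'rV[R]_n) (r s : 'rV[R]_n).

Record root_system Phi : Prop := RootSystem {
  root_finite : finite_set Phi;
  root_nonzero : forall r, Phi r -> r != 0;
  root_span : exists B : 'M[R]_n, (B \in unitmx) /\ (forall i, Phi (row i B));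
  root_refl : forall r s, Phi r -> Phi s -> Phi (refl r s);
  root_integral : forall r s, Phi r -> Phi s ->
    2 * dot s r / dot r r \is a Num.int;
  root_reduced : forall r (c : R), Phi r -> Phi (c *: r) -> c = 1 \/ c = -1
}.

(* The rows of B are a base (a system of simple roots) of Phi. *)
Definition root_base Phi (B : 'M[R]_n) : Prop :=
  [/\ B \in unitmx,
      (forall i, Phi (row i B))
    & forall r, Phi r -> exists c : 'I_n -> nat,
        r = \sum_i (c i)%:R *: row i B \/ r = - \sum_i (c i)%:R *: row i B].

(* Phi is a root system of type D_5, E_6, E_7 when n = 5, 6, 7. *)
Definition root_system_E Phi : Prop :=
  root_system Phi /\
  exists B : 'M[R]_n, root_base Phi B /\
    forall i j, 2 * dot (row i B) (row j B) / dot (row j B) (row j B)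
                = E_cartan R i j.

Definition kissing_configuration Phi : set 'rV[R]_n :=
  [set (euclid_norm r)^-1 *: r | r in Phi].

Definition contact_polytope Phi : set 'rV[R]_n :=
  conv_hull (kissing_configuration Phi).

End RootSystems.

Section Gosset.
Context {R : realType} {n : nat}.

(* The orbit of x under the group generated by the reflections in the alpha i. *)
Inductive refl_orbit (m : nat) (alpha : 'I_m -> 'rV[R]_n) (x : 'rV[R]_n) :
    'rV[R]_n -> Prop :=
  | refl_orbit_base : refl_orbit alpha x x
  | refl_orbit_step i y :
      refl_orbit alpha x y -> refl_orbit alpha x (refl (alpha i) y).

(* Coxeter's k_21, of any size and position in R^n, by Wythoff's construction:
   the mirrors form the diagram E_(k+4), whose arms at the node 2 have lengths
   k, 2 and 1, and the ringed node is k+2, the end of the arm of length k (the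
   node 2 itself if k = 0).  0_21 is the rectified 5-cell, 1_21 the 5-demicube,
   2_21 the Gosset polytope with 27 vertices. *)
Definition gosset_k21 (k : nat) (F : set 'rV[R]_n) : Prop :=
  exists (alpha : 'I_k.+4 -> 'rV[R]_n) (omega center : 'rV[R]_n),
    [/\ (forall i j, dot (alpha i) (alpha j) = E_cartan R i j),
        (forall i, val i != k.+2 -> dot omega (alpha i) = 0),
        (forall i, val i = k.+2 -> 0 < dot omega (alpha i))
      & F = conv_hull [set center + x | x in refl_orbit alpha omega]].

End Gosset.

(* Main.v *)
(* Write kappa = 1 / (10 - n).  The vertices of F are normalized roots, so
   4 (x . y)^2 is an integer for any two of them; as the orbit of vertices of
   k_21 has only two distances, in the ratio 1 : sqrt 2, the inner products of
   distinct vertices are 1/2 (edges) and 0 (diagonals of squares).  Hence the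
   hyperplane v . x = 1/2 cuts F exactly in the vertex figure G of v, the pyramid
   and the diminished cell being the parts above and below it.  An isometry that
   fixes G pointwise and sends some vertex of a piece off G to a unit vector acts
   on aff F as the identity or as the reflection in the hyperplane spanned by 0
   and G.  So the second copy of a piece is its mirror image, and the angles can
   be computed in the plane of v and of the foot e of the perpendicular from 0 to
   aff F, where |e|^2 = (1 - kappa) / 2. *)
Require Import Defs.
From HB Require Import structures.
From mathcomp Require Import all_boot all_order all_algebra.
From mathcomp Require Import all_classical all_reals all_analysis.
From mathcomp Require Import ring lra zify.

Set Implicit Arguments.
Unset Strict Implicit.
Unset Printing Implicit Defensive.

Import Order.TTheory GRing.Theory Num.Theory.
Import numFieldNormedType.Exports.

Local Open Scope classical_set_scope.
Local Open Scope ring_scope.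

(** * Inner products, convex hulls and affine hulls *)

Section InnerProduct.
Context {R : realType} {n : nat}.
Implicit Types (x y z a b : 'rV[R]_n) (t : R).

Lemma dotE x y : dot x y = \sum_i x 0 i * y 0 i.
Proof. by rewrite /dot mxE; apply: eq_bigr => i _; rewrite mxE. Qed.

Lemma dotC x y : dot x y = dot y x.
Proof. by rewrite !dotE; apply: eq_bigr => i _; rewrite mulrC. Qed.

Lemma dotDl x y z : dot (x + y) z = dot x z + dot y z.
Proof. by rewrite /dot mulmxDl mxE. Qed.

Lemma dotZl t x z : dot (t *: x) z = t * dot x z.
Proof. by rewrite /dot -scalemxAl mxE. Qed.

Lemma dotNl x z : dot (- x) z = - dot x z.
Proof. by rewrite -scaleN1r dotZl mulN1r. Qed.

Lemma dot0l z : dot 0 z = 0.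
Proof. by rewrite -(scale0r z) dotZl mul0r. Qed.

Lemma dotDr x y z : dot z (x + y) = dot z x + dot z y.
Proof. by rewrite !(dotC z) dotDl. Qed.

Lemma dotZr t x z : dot z (t *: x) = t * dot z x.
Proof. by rewrite !(dotC z) dotZl. Qed.

Lemma dotNr x z : dot z (- x) = - dot z x.
Proof. by rewrite !(dotC z) dotNl. Qed.

Lemma dot0r z : dot z 0 = 0.
Proof. by rewrite dotC dot0l. Qed.

Definition dot_linE := (dotDl, dotDr, dotNl, dotNr, dotZl, dotZr).

Lemma dot_suml (I : finType) (f : I -> 'rV[R]_n) z :
  dot (\sum_i f i) z = \sum_i dot (f i) z.
Proof. by rewrite /dot mulmx_suml summxE. Qed.

Lemma dot_sumr (I : finType) (f : I -> 'rV[R]_n) z :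
  dot z (\sum_i f i) = \sum_i dot z (f i).
Proof. by rewrite dotC dot_suml; apply: eq_bigr => i _; rewrite dotC. Qed.

Lemma dot_ge0 x : 0 <= dot x x.
Proof. by rewrite dotE; apply: sumr_ge0 => i _; rewrite -expr2 sqr_ge0. Qed.

Lemma dot_eq0 x : dot x x = 0 -> x = 0.
Proof.
rewrite dotE => /eqP; rewrite psumr_eq0 => [/allP h|i _]; last first.
  by rewrite -expr2 sqr_ge0.
apply/rowP => i; have := h i (mem_index_enum _).
by rewrite -expr2 sqrf_eq0 mxE => /eqP.
Qed.

Lemma dot_gt0 x : x != 0 -> 0 < dot x x.
Proof.
by move=> x0; rewrite lt_def dot_ge0 andbT; apply: contraNneq x0 => /dot_eq0->.
Qed.

Lemma isometry_dot f x y : Defs.isometry f ->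
  dot (f x - f y) (f x - f y) = dot (x - y) (x - y).
Proof.
move=> /(_ x y) /(congr1 (fun t => t ^+ 2)).
by rewrite /euclid_norm !sqr_sqrtr ?dot_ge0.
Qed.

Lemma reflD a x y : refl a (x + y) = refl a x + refl a y.
Proof. by apply/rowP => i; rewrite /refl dotDl !mxE; ring. Qed.

Lemma reflZ a t x : refl a (t *: x) = t *: refl a x.
Proof. by apply/rowP => i; rewrite /refl dotZl !mxE; ring. Qed.

Lemma reflB a x y : refl a (x - y) = refl a x - refl a y.
Proof. by rewrite reflD -[- y]scaleN1r reflZ scaleN1r. Qed.

Lemma refl_sum a (I : finType) (f : I -> 'rV[R]_n) :
  refl a (\sum_i f i) = \sum_i refl a (f i).
Proof.
apply: (big_morph _ (reflD a)); have := reflZ a 0 0.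
by rewrite !scale0r.
Qed.

Lemma refl_id a x : dot x a = 0 -> refl a x = x.
Proof. by move=> xa; rewrite /refl xa mulr0 mul0r scale0r subr0. Qed.

Lemma dot_refl a x y : a != 0 -> dot (refl a x) (refl a y) = dot x y.
Proof.
move=> /dot_gt0; rewrite lt_def => /andP[a0 _].
rewrite /refl !dot_linE (dotC a y).
by field.
Qed.

Lemma reflK a : a != 0 -> involutive (refl a).
Proof.
move=> /dot_gt0; rewrite lt_def => /andP[a0 _] x.
by apply/rowP => i; rewrite /refl !dot_linE !mxE; field.
Qed.

(** The reflection preserves the norm of [x], so the hypothesis gives [c] equal inner products with
    [x] and its image, which differ by a nonzero multiple of [a]. This will place the center of the
    polytope on every mirror. *)
Lemma refl_center a c x : dot (c + refl a x) (c + refl a x) = dot (c + x) (c + x) ->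
  dot x a != 0 -> dot c a = 0.
Proof.
move=> + xa0; have a0 : a != 0 by apply: contraNneq xa0 => ->; rewrite dot0r.
have a2 : dot a a != 0 by rewrite gt_eqF// dot_gt0.
have xx := dot_refl x x a0; have [y yE] : exists y, y = refl a x by eexists.
rewrite -yE in xx *; rewrite !dot_linE (dotC y c) (dotC x c) xx => h.
have {h} : dot c y = dot c x by lra.
rewrite yE /refl dotDr dotNr dotZr => h.
have /eqP : 2 * dot x a / dot a a * dot c a = 0 by lra.
by rewrite !mulf_eq0 pnatr_eq0 invr_eq0 (negPf xa0) (negPf a2)/= => /eqP.
Qed.

Lemma refl_imageK a (A : set 'rV[R]_n) : a != 0 ->
  refl a @` (refl a @` A) = A.
Proof.
move=> a0; apply/seteqP; split=> [_ [_ [x Ax <-] <-]|x Ax]; first by rewrite reflK.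
by exists (refl a x); [exists x|rewrite reflK].
Qed.

Lemma isometry_refl a : a != 0 -> Defs.isometry (refl a).
Proof. by move=> a0 x y; rewrite /euclid_norm -!reflB dot_refl. Qed.

End InnerProduct.

(** * Convex sets, extreme points and faces *)

Section Convexity.
Context {R : realType} {n : nat}.
Implicit Types (x y a : 'rV[R]_n) (t c : R) (A B K P F : set 'rV[R]_n).

Lemma convexP A : @convex_set R 'rV[R]_n A <->
  forall x y t, A x -> A y -> 0 < t -> t < 1 -> A (t *: x + (1 - t) *: y).
Proof.
split=> [cA x y t Ax Ay t0 t1|cA].
  have t01 : Itv.spec (@Itv.num_sem R) (Itv.Real `[0%Z, 1%Z]) t.
    by rewrite /= /Itv.num_sem/= realE (ltW t0)/= in_itv/= (ltW t0) (ltW t1).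
  have := cA x y (Itv.mk t01); rewrite !inE => /(_ Ax Ay).
  by [].
apply/convex_setW => x y; rewrite !inE => Ax Ay k k0 k1; rewrite inE.
exact: cA.
Qed.

Lemma conv_hull_convex A : @convex_set R 'rV[R]_n (conv_hull A).
Proof.
apply/convexP => x y t Ax Ay t0 t1 B [cB AB].
by move/convexP: (cB); apply => //; [exact: Ax|exact: Ay].
Qed.

Lemma sub_conv_hull A : A `<=` conv_hull A.
Proof. exact: sub_gen_smallest. Qed.

Lemma conv_hull_min A B : @convex_set R 'rV[R]_n B -> A `<=` B -> conv_hull A `<=` B.
Proof. by move=> cB AB x; apply. Qed.

Lemma conv_hull_mono A B : A `<=` B -> conv_hull A `<=` conv_hull B.
Proof.
move=> AB; apply: conv_hull_min; first exact: conv_hull_convex.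
exact: subset_trans AB (@sub_conv_hull B).
Qed.

Lemma convexI A B : @convex_set R 'rV[R]_n A -> @convex_set R 'rV[R]_n B ->
  @convex_set R 'rV[R]_n (A `&` B).
Proof.
move=> /convexP cA /convexP cB; apply/convexP => x y t [? ?] [? ?] t0 t1.
by split; [apply: cA|apply: cB].
Qed.

Lemma convex_halfspace a c : @convex_set R 'rV[R]_n [set x | dot a x <= c].
Proof. by apply/convexP => x y t /= ax ay t0 t1; rewrite !dot_linE; nra. Qed.

Lemma convex_hyperplane a c : @convex_set R 'rV[R]_n [set x | dot a x = c].
Proof. by apply/convexP => x y t /= ax ay t0 t1; rewrite !dot_linE ax ay; ring. Qed.

Lemma convex_segment A x y t : @convex_set R 'rV[R]_n A -> A x -> A y ->
  0 <= t <= 1 -> A (t *: x + (1 - t) *: y).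
Proof.
move=> /convexP cA Ax Ay /andP[]; rewrite le_eqVlt => /predU1P[<- _|t0].
  by rewrite scale0r add0r subr0 scale1r.
rewrite le_eqVlt => /predU1P[->|t1]; last exact: cA.
by rewrite scale1r subrr scale0r addr0.
Qed.

Lemma convex_set1 x : @convex_set R 'rV[R]_n [set x].
Proof.
by apply/convexP => _ _ t -> -> _ _; rewrite -scalerDl addrC subrK scale1r.
Qed.

(** The segments from [v] to points of the hull of [A] already fill a convex set. *)
Lemma conv_hull_point A v x : A !=set0 -> conv_hull (v |` A) x ->
  exists t y, [/\ 0 <= t <= 1, conv_hull A y & x = t *: v + (1 - t) *: y].
Proof.
move=> [a Aa].
suff : conv_hull (v |` A) `<=` [set x | exists t y,
    [/\ 0 <= t <= 1, conv_hull A y & x = t *: v + (1 - t) *: y]].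
  by move=> h /h.
have hull := @sub_conv_hull A.
apply: conv_hull_min; last first.
  move=> y [->|Ay]; first exists 1, a; last exists 0, y.
    split=> //; [by rewrite ler01 lexx|exact: hull|].
    by rewrite scale1r subrr scale0r addr0.
  split=> //; [by rewrite ler01 lexx|exact: hull|].
  by rewrite scale0r subr0 scale1r add0r.
apply/convexP => _ _ s [t1 [y1 [/andP[t10 t11] Ay1 ->]]] [t2 [y2
  [/andP[t20 t21] Ay2 ->]]] s0 s1.
(* This sum is the total weight of [v]. If it is 1, both points are [v] and any point of the hull
   serves; otherwise the remaining weights are normalized. *)
have [T1|] := eqVneq (s * t1 + (1 - s) * t2) 1.
  have t1E : t1 = 1 by nra.
  have t2E : t2 = 1 by nra.
  exists 1, y1; split => //; first by rewrite ler01 lexx.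
  by apply/rowP => i; rewrite !mxE t1E t2E; ring.
set T := s * t1 + (1 - s) * t2 => T1.
have T0 : 0 < 1 - T by rewrite subr_gt0 lt_neqAle T1 /T /=; nra.
exists T, ((s * (1 - t1) / (1 - T)) *: y1 + (1 - s * (1 - t1) / (1 - T)) *: y2).
split; first by rewrite /T; apply/andP; split; nra.
  apply: convex_segment => //; first exact: conv_hull_convex.
  rewrite divr_ge0 ?(ltW T0)//=; last by nra.
  by rewrite ler_pdivrMr// /T; nra.
by apply/rowP => i; rewrite !mxE /T; field; rewrite gt_eqF.
Qed.

Lemma conv_hull_refl b A : b != 0 ->
  conv_hull (refl b @` A) = refl b @` conv_hull A.
Proof.
move=> b0.
have incl B : conv_hull (refl b @` B) `<=` refl b @` conv_hull B.
  apply: conv_hull_min; last first.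
    by move=> _ [x Bx <-]; exists x => //; exact: sub_conv_hull.
  apply/convexP => _ _ t [x Bx <-] [y By <-] t0 t1.
  exists (t *: x + (1 - t) *: y); last by rewrite reflD !reflZ.
  by have /convexP := @conv_hull_convex B; apply.
apply/seteqP; split; first exact: incl.
move=> _ [x Ax <-]; rewrite -{1}(refl_imageK A b0) in Ax.
have [y Hy <-] := incl _ _ Ax.
by rewrite reflK.
Qed.

(** In this form, minimality of the hull shows at once that an extreme point of a hull is one of its
    generators. *)
Definition extreme P x := P x /\ @convex_set R 'rV[R]_n (P `\ x).

Lemma extreme_conv_hull A x : extreme (conv_hull A) x -> A x.
Proof.
move=> [hx cx]; apply: contrapT => Ax.
have [_ /(_ erefl)] : (conv_hull A `\ x) x; last by [].
apply: (conv_hull_min cx) (hx) => y Ay; split; first exact: sub_conv_hull.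
by move=> yx; apply: Ax; rewrite -yx.
Qed.

Lemma extreme_sub A B x : @convex_set R 'rV[R]_n A -> A `<=` B -> A x ->
  extreme B x -> extreme A x.
Proof.
move=> cA AB Ax [_ cx]; split=> //.
have -> : A `\ x = A `&` (B `\ x); last exact: convexI.
apply/seteqP; split=> y [Ay].
  by move=> yx; split=> //; split=> //; exact: AB.
by move=> [_ yx]; split.
Qed.

(** A functional that attains its maximum inside a segment attains it at both ends, so a segment of
    [P] through [x] lies in the face. *)
Lemma extreme_face P F x : @convex_set R 'rV[R]_n P -> face P F ->
  extreme F x -> extreme P x.
Proof.
move=> /convexP cP [a [c [aP ->]]] [[Px ax] /convexP cx].
split=> //; apply/convexP => y z t [Py yx] [Pz zx] t0 t1.
split=> [|/= xE]; first exact: cP.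
have := aP _ Py; have := aP _ Pz => az ay.
have := ax; rewrite -xE !dot_linE => axE.
have ayE : dot a y = c by nra.
have azE : dot a z = c by nra.
by have [_] := cx y z t (conj (conj Py ayE) yx) (conj (conj Pz azE) zx) t0 t1.
Qed.

Lemma face_sub P F : face P F -> F `<=` P.
Proof. by move=> [a [c [_ ->]]] x []. Qed.

Lemma extreme_set1 x : extreme [set x] x.
Proof.
split=> //; apply/convexP => y z t [/= -> //].
Qed.

Lemma vertex_extreme P x : @convex_set R 'rV[R]_n P -> vertex P x -> extreme P x.
Proof. by move=> cP /extreme_face; apply => //; exact: extreme_set1. Qed.

(** The union of [K] and the open halfspace below level [c] is convex, because mixing in a point
    strictly below keeps the mixture strictly below. All vertices and edges are exhibited in this
    way. *)
Lemma face_conv_hull A K a c : @convex_set R 'rV[R]_n K -> K `<=` conv_hull A ->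
  (forall x, K x -> dot a x = c) -> (forall x, A x -> K x \/ dot a x < c) ->
  face (conv_hull A) K.
Proof.
move=> /convexP cK KA Kc AK.
have hull : conv_hull A `<=` [set x | K x \/ dot a x < c].
  apply: conv_hull_min AK; apply/convexP => x y t Kx Ky t0 t1 /=.
  case: Kx Ky => [Kx|ax] [Ky|ay]; first by left; exact: cK.
  - by right; rewrite !dot_linE (Kc x)//; nra.
  - by right; rewrite !dot_linE (Kc y)//; nra.
  - by right; rewrite !dot_linE; nra.
exists a, c; split=> [x /hull [/Kc ->|/ltW]//|].
apply/seteqP; split=> x; first by move=> Kx; split; [exact: KA|exact: Kc].
by move=> [/hull[]// ax axE]; move: ax; rewrite axE ltxx.
Qed.

End Convexity.

(** * Affine hulls and dimension *)

Section AffineHull.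
Context {R : realType} {n : nat}.
Implicit Types (x y z a : 'rV[R]_n) (t c : R) (A B : set 'rV[R]_n).

Lemma sub_aff_hull A : A `<=` aff_hull A.
Proof.
move=> x Ax; exists 1%N, (fun=> x), (fun=> 1).
by rewrite !big_ord1 scale1r.
Qed.

Lemma aff_hull_mono A B : A `<=` B -> aff_hull A `<=` aff_hull B.
Proof.
by move=> AB x [m [p [c [Ap c1 xE]]]]; exists m, p, c; split=> // i; exact: AB.
Qed.

Lemma aff_hull_comb A x y z t : aff_hull A x -> aff_hull A y -> aff_hull A z ->
  aff_hull A (x + t *: (y - z)).
Proof.
move=> [m1 [p1 [c1 [Ap1 s1 ->]]]] [m2 [p2 [c2 [Ap2 s2 ->]]]].
move=> [m3 [p3 [c3 [Ap3 s3 ->]]]].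
(* The three families are concatenated; the last two get their weights multiplied by [t] and [- t],
   so the total stays 1. *)
pose p (i : 'I_(m1 + (m2 + m3))) := match fintype.split i with
  | inl j => p1 j
  | inr j => match fintype.split j with inl k => p2 k | inr k => p3 k end
  end.
pose c (i : 'I_(m1 + (m2 + m3))) := match fintype.split i with
  | inl j => c1 j
  | inr j => match fintype.split j with inl k => t * c2 k | inr k => - t * c3 k end
  end.
have split1 (i : 'I_m1) : fintype.split (lshift (m2 + m3) i) = inl i.
  exact: (unsplitK (inl i)).
have split2 (i : 'I_(m2 + m3)) : fintype.split (rshift m1 i) = inr i.
  exact: (unsplitK (inr i)).
have split3 (i : 'I_m2) : fintype.split (lshift m3 i) = inl i.
  exact: (unsplitK (inl i)).
have split4 (i : 'I_m3) : fintype.split (rshift m2 i) = inr i.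
  exact: (unsplitK (inr i)).
exists (m1 + (m2 + m3))%N, p, c; split.
- by move=> i; rewrite /p; case: fintype.split => // j; case: fintype.split.
- rewrite !big_split_ord/= /c.
  under eq_bigr do rewrite split1.
  under [X in _ + (X + _)]eq_bigr do rewrite split2 split3.
  under [X in _ + (_ + X)]eq_bigr do rewrite split2 split4.
  by rewrite -!mulr_sumr s1 s2 s3; ring.
- rewrite !big_split_ord/= /c /p.
  under [X in _ = X + _]eq_bigr do rewrite split1.
  under [X in _ = _ + (X + _)]eq_bigr do rewrite split2 split3 -scalerA.
  under [X in _ = _ + (_ + X)]eq_bigr do rewrite split2 split4 -scalerA.
  by rewrite -!scaler_sumr scaleNr scalerBr.
Qed.

Lemma aff_hull_hyperplane A a c : A `<=` [set x | dot a x = c] ->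
  aff_hull A `<=` [set x | dot a x = c].
Proof.
move=> Ac x [m [p [s [Ap s1 ->]]]] /=; rewrite dot_sumr.
under eq_bigr do rewrite dotZr Ac//.
by rewrite -mulr_suml s1 mul1r.
Qed.

Lemma aff_hull_refl b A : b != 0 -> aff_hull (refl b @` A) = refl b @` aff_hull A.
Proof.
move=> b0.
have incl B : aff_hull (refl b @` B) `<=` refl b @` aff_hull B.
  move=> x [m [p [s [Bp s1 ->]]]].
  exists (\sum_i s i *: refl b (p i)).
    exists m, (fun i => refl b (p i)), s; split=> // i.
    by have [y By <-] := Bp i; rewrite reflK.
  by rewrite refl_sum; apply: eq_bigr => i _; rewrite reflZ reflK.
apply/seteqP; split; first exact: incl.
move=> _ [x Ax <-].
rewrite -{1}(refl_imageK A b0) in Ax.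
have [y Hy <-] := incl _ _ Ax.
by rewrite reflK.
Qed.

Lemma has_dim_set (K : 'M[R]_n) p A d : \rank K = d ->
  aff_hull A = [set x | (x - p <= K)%MS] -> has_dim A d.
Proof.
move=> <- AE; exists p, (row_base K); split; first exact: row_base_free.
rewrite AE; apply/seteqP; split=> x /=.
  rewrite -(eq_row_base K) => /submxP[t xp]; exists t => //.
  by rewrite -xp addrC subrK.
by move=> [t _ <-]; rewrite addrC addKr -(eq_row_base K) submxMl.
Qed.

End AffineHull.

(** * Folding along a vertex figure *)

Section Isometries.
Context {R : realType} {n : nat}.
Implicit Types (x y z p q : 'rV[R]_n) (f : 'rV[R]_n -> 'rV[R]_n) (Q : set 'rV[R]_n).

Lemma isometry_dot2 f x y z : Defs.isometry f ->
  dot (f x - f z) (f y - f z) = dot (x - z) (y - z).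
Proof.
move=> If; have := isometry_dot x y If; have := isometry_dot x z If.
have := isometry_dot y z If.
by rewrite !dot_linE (dotC y x) (dotC (f y) (f x)) (dotC z x) (dotC (f z) (f x))
  (dotC z y) (dotC (f z) (f y)); lra.
Qed.

(** No linearity of [f] is assumed: by polarization, the functional of [f a - f 0] at [f x] differs
    from that of [a] at [x] by a constant, so supporting functionals are transported. *)
Lemma isometry_vertex f Q q : Defs.isometry f ->
  vertex Q q -> vertex (f @` Q) (f q).
Proof.
move=> If [a [c [aQ qE]]].
have aE x : dot (f a - f 0) (f x) = dot a x + dot (f a - f 0) (f 0).
  have := isometry_dot2 a x 0 If; rewrite !subr0 => <-.
  by rewrite !dot_linE; ring.
exists (f a - f 0), (c + dot (f a - f 0) (f 0)); split.
  by move=> _ [x Qx <-]; rewrite aE lerD2r; exact: aQ.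
have [Qq aq] : Q q /\ dot a q = c.
  by have : [set q] q by []; rewrite qE.
apply/seteqP; split=> [_ ->|_ [[x Qx <-]]].
  by split; [exists q|rewrite aE aq].
rewrite aE => /addIr ax; suff -> : x = q by [].
by have : [set q] x by rewrite qE.
Qed.

End Isometries.

(* X is the set of vertices of F, [k] stands for kappa, and [y0] is the vertex
   opposite to [v] in some square. *)
Section Fold.
Context {R : realType} {n : nat} (X : set 'rV[R]_n) (e v y0 : 'rV[R]_n) (k : R).
Hypotheses (k0 : 0 < k) (k1 : k < 1).
Hypothesis X_unit : forall x, X x -> dot x x = 1.
Hypothesis X_dot : forall x y, X x -> X y ->
  [\/ x = y, dot x y = 1 / 2 | dot x y = 0].
Hypothesis X_square : forall x y, X x -> X y -> dot x y = 0 -> exists g h,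
  [/\ X g, X h, dot x g = 1 / 2, dot x h = 1 / 2 & g + h = x + y].
Hypothesis ee : dot e e = (1 - k) / 2.
Hypothesis X_e : forall x, X x -> dot e x = (1 - k) / 2.
(** A spanning condition phrased through closure properties, so that it can be applied to any
    predicate shown to define a subspace. *)
Hypothesis X_span : forall S : set 'rV[R]_n,
  (forall x y, S x -> S y -> S (x + y)) -> (forall t x, S x -> S (t *: x)) ->
  (forall x y, X x -> X y -> S (x - y)) -> forall z, dot e z = 0 -> S z.
Hypotheses (Xv : X v) (Xy0 : X y0) (vy0 : dot v y0 = 0).
Implicit Types (x y z g q : 'rV[R]_n) (t s : R) (Q : set 'rV[R]_n).

Let F := conv_hull X.
Let G := vertex_figure F v.
Let N := [set g | X g /\ dot v g = 1 / 2].

(** * The vertex figure and the two pieces as cuts of F *)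

Let vv : dot v v = 1. Proof. exact: X_unit. Qed.
Let ev : dot e v = (1 - k) / 2. Proof. exact: X_e. Qed.
Let ve : dot v e = (1 - k) / 2. Proof. by rewrite dotC. Qed.
Let F_convex : @convex_set R 'rV[R]_n F. Proof. exact: conv_hull_convex. Qed.
Let X_F x : X x -> F x. Proof. exact: sub_conv_hull. Qed.

Let X_le v0 x : X v0 -> X x -> v0 = x \/ dot v0 x <= 1 / 2.
Proof. by move=> /X_dot /[apply] -[->|->|->]; [left|right; lra|right; lra]. Qed.

Let X_vertex x : X x -> vertex F x.
Proof.
move=> Xx; apply: (@face_conv_hull _ _ _ _ x 1).
- exact: convex_set1.
- by move=> _ ->; exact: X_F.
- by move=> _ ->; exact: X_unit.
- by move=> y /(X_le Xx)[->|xy]; [left|right; lra].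
Qed.

(** The diagonal of a square is no edge: the other diagonal has the same midpoint, so a face
    containing one contains both. *)
Lemma joined_iff : [set g | joined_by_edge F v g] = N.
Proof.
apply/seteqP; split=> g /=.
  move=> [vg _ /(vertex_extreme F_convex)/extreme_conv_hull Xg fvg].
  split=> //; case: (X_dot Xv Xg) => // vg0.
  have [h1 [h2 [Xh1 Xh2 vh1 vh2 h12]]] := X_square Xv Xg vg0.
  have seg : conv_hull [set v; g] h1.
    case: fvg => a [c [aF segE]].
    have : conv_hull [set v; g] v by apply: sub_conv_hull; left.
    have : conv_hull [set v; g] g by apply: sub_conv_hull; right.
    rewrite segE => -[_ ag] [_ av]; split; first exact: X_F.
    have := aF _ (X_F Xh1); have := aF _ (X_F Xh2).
    by have := congr1 (dot a) h12; rewrite !dot_linE; lra.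
  have [h1v|h1g] : [set v; g] h1.
    apply: extreme_conv_hull; apply: (@extreme_sub _ _ _ F) => //.
    - exact: conv_hull_convex.
    - by apply: conv_hull_min => // _ [->|->]; exact: X_F.
    - by apply: vertex_extreme => //; exact: X_vertex.
  - by move: vh1; rewrite h1v vv; lra.
  - by move: vh1; rewrite h1g vg0; lra.
move=> [Xg vg]; split; try exact: X_vertex.
  by move=> vgE; move: vg; rewrite -vgE vv; lra.
(* The functional [v + g] equals 1 + 1/2 at [v] and at [g], and is at most 1/2 + 1/2 at every other
   vertex. *)
apply: (@face_conv_hull _ _ _ _ (v + g) (3 / 2)).
- exact: conv_hull_convex.
- by apply: conv_hull_min => // _ [->|->]; exact: X_F.
- move=> x; suff : conv_hull [set v; g] `<=` [set x | dot (v + g) x = 3 / 2].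
    exact.
  apply: conv_hull_min; first exact: convex_hyperplane.
  by move=> _ [->|->] /=; rewrite !dot_linE ?(dotC g v) ?vv ?vg ?X_unit//; lra.
- move=> x Xx; case: (X_le Xv Xx) => [<-|vx].
    by left; apply: sub_conv_hull; left.
  case: (X_le Xg Xx) => [<-|gx]; first by left; apply: sub_conv_hull; right.
  by right; rewrite dotDl; lra.
Qed.

Lemma vertex_figureE : G = conv_hull N.
Proof. by rewrite /G /vertex_figure joined_iff. Qed.

Let N_G g : N g -> G g.
Proof. by rewrite vertex_figureE; exact: sub_conv_hull. Qed.

Let G_convex : @convex_set R 'rV[R]_n G. Proof. exact: conv_hull_convex. Qed.

Let G_F : G `<=` F.
Proof.
by rewrite vertex_figureE; apply: conv_hull_min => // g [Xg _]; exact: X_F.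
Qed.

Let G_v g : G g -> dot v g = 1 / 2.
Proof.
rewrite vertex_figureE; suff : conv_hull N `<=` [set x | dot v x = 1 / 2] by exact.
by apply: conv_hull_min => [|x []//]; exact: convex_hyperplane.
Qed.

Let F_e x : F x -> dot e x = (1 - k) / 2.
Proof.
suff : F `<=` [set x | dot e x = (1 - k) / 2] by exact.
by apply: conv_hull_min => //; exact: convex_hyperplane.
Qed.

Let G_e g : G g -> dot e g = (1 - k) / 2. Proof. by move=> /G_F/F_e. Qed.

Let N_ex : exists g, N g.
Proof. by have [g [h [Xg Xh vg vh _]]] := X_square Xv Xy0 vy0; exists g. Qed.

(** The cone with apex [v] over [G] is convex, so only the vertices matter: [v] has t = 0, its
    neighbours t = 1, and a vertex opposite to [v] in a square has t = 2, with the center of the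
    square as the point of [G]. *)
Lemma vertex_cone :
  F `<=` [set x | exists t g, [/\ 0 <= t, G g & x = v + t *: (g - v)]].
Proof.
have [g0 Ng0] := N_ex.
apply: conv_hull_min.
  apply/convexP => _ _ s [t1 [g1 [t10 Gg1 ->]]] [t2 [g2 [t20 Gg2 ->]]] s0 s1.
  (* With [t1 = 0] the first point is the apex; setting this case aside keeps the denominator of [r]
     positive. *)
  have [t10'|t1n0] := eqVneq t1 0.
    exists ((1 - s) * t2), g2; split=> //; first by nra.
    by apply/rowP => i; rewrite !mxE t10'; ring.
  have T0 : 0 < s * t1 + (1 - s) * t2.
    have : 0 < t1 by rewrite lt_def t1n0.
    by nra.
  pose r := s * t1 / (s * t1 + (1 - s) * t2).
  exists (s * t1 + (1 - s) * t2), (r *: g1 + (1 - r) *: g2); split.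
  - exact: ltW.
  - apply: convex_segment => //; rewrite divr_ge0 ?(ltW T0)//=; last by nra.
    by rewrite ler_pdivrMr//; nra.
  - by apply/rowP => i; rewrite !mxE /r; field; rewrite gt_eqF.
move=> x Xx; case: (X_dot Xv Xx) => [<-|vx|vx0].
- exists 0, g0; split=> //; first exact: N_G.
  by rewrite scale0r addr0.
- exists 1, x; split=> //; first exact: N_G.
  by rewrite scale1r addrC subrK.
- have [g [h [Xg Xh vg vh gh]]] := X_square Xv Xx vx0.
  exists 2, (2^-1 *: g + (1 - 2^-1) *: h); split=> //.
    by apply: convex_segment; [|exact: N_G|exact: N_G|lra].
  have := gh => /rowP gh'; apply/rowP => i; have := gh' i.
  by rewrite !mxE; lra.
Qed.

(** On the cone of [vertex_cone], [dot v x] is 1 - t/2, so the cut is t = 1; the pyramid is then the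
    part with t at most 1. *)
Lemma vertex_figure_cut : G = [set x | F x /\ dot v x = 1 / 2].
Proof.
apply/seteqP; split=> [x Gx|x /= [Fx vx]]; first by split; [exact: G_F|exact: G_v].
have [t [g [t0 Gg xE]]] := vertex_cone Fx.
suff t1 : t = 1 by rewrite xE t1 scale1r addrC subrK.
by move: vx; rewrite xE !dot_linE vv (G_v Gg); lra.
Qed.

Lemma pyramid_cut : pyramid v G = [set x | F x /\ 1 / 2 <= dot v x].
Proof.
apply/seteqP; split.
  apply: conv_hull_min.
    have -> : [set x | F x /\ 1 / 2 <= dot v x] =
              F `&` [set x | dot (- v) x <= - (1 / 2)].
      by apply/seteqP; split=> x /= [Fx vx]; split=> //; move: vx;
         rewrite dotNl lerN2.
    by apply: convexI => //; exact: convex_halfspace.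
  move=> x [->|Gx]; first by split; [exact: X_F|rewrite vv; lra].
  by split; [exact: G_F|rewrite G_v].
move=> x [Fx vx]; have [t [g [t0 Gg xE]]] := vertex_cone Fx.
have t1 : t <= 1 by move: vx; rewrite xE !dot_linE vv (G_v Gg); lra.
have -> : x = t *: g + (1 - t) *: v.
  by rewrite xE; apply/rowP => i; rewrite !mxE; ring.
apply: convex_segment; [exact: conv_hull_convex| | |by rewrite t0].
- by apply: sub_conv_hull; right.
- by apply: sub_conv_hull; left.
Qed.

Lemma diminished_cell_cut : diminished_cell F v = [set x | F x /\ dot v x <= 1 / 2].
Proof.
rewrite /diminished_cell -/G pyramid_cut vertex_figure_cut.
apply/seteqP; split=> x /=.
  move=> [[Fx nx]|[Fx ->]//]; split=> //; rewrite leNgt; apply/negP => xv.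
  by apply: nx; split=> //; exact: ltW.
move=> [Fx]; rewrite le_eqVlt => /predU1P[vx|vx]; first by right.
by left; split=> // -[_]; rewrite leNgt vx.
Qed.

Let Y := [set x | X x /\ dot v x <= 1 / 2].

Let F_Y x : F x -> conv_hull (v |` Y) x.
Proof.
apply: conv_hull_mono => y Xy; case: (X_le Xv Xy) => [<-|vy]; first by left.
by right.
Qed.

(** A point [x] below the cut is a mixture of [v] and some [y] in the hull of the other vertices.
    The segment from [v] to [y] crosses [G] at [g] before it reaches [x], so [x] lies between [g]
    and [y]. *)
Lemma diminished_cell_conv : diminished_cell F v = conv_hull Y.
Proof.
rewrite diminished_cell_cut; apply/seteqP; split; last first.
  apply: conv_hull_min => [|x [Xx vx]]; last by split=> //; exact: X_F.
  by apply: convexI => //; exact: convex_halfspace.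
move=> x [Fx vx]; have [g0 [Xg0 vg0]] := N_ex.
have Y0 : Y !=set0 by exists g0; split=> //; lra.
have [s [y [/andP[s0 s1] Yy xE]]] := conv_hull_point Y0 (F_Y Fx).
have [t [g [t0 Gg xE']]] := vertex_cone Fx.
have Yg : conv_hull Y g.
  move: Gg; rewrite vertex_figureE; apply: conv_hull_mono => h [Xh vh].
  by split=> //; lra.
have t1 : 1 <= t by move: vx; rewrite xE' !dot_linE vv (G_v Gg); lra.
have [s00|sn0] := eqVneq s 0; first by rewrite xE s00 scale0r add0r subr0 scale1r.
have sn1 : s != 1.
  apply/eqP => s1'; move: vx; rewrite xE s1' !dot_linE vv; lra.
have sp : 0 < s by rewrite lt_def sn0.
have D0 : 0 < t - 1 + s by lra.
(* The solution of x = r g + (1 - r) y, given x - v = t (g - v) = (1 - s)(y - v). *)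
pose r := s * t / (t - 1 + s).
have -> : x = r *: g + (1 - r) *: y.
  have /rowP xE1 := xE; have /rowP xE2 := etrans (esym xE') xE.
  apply/rowP => i; have := xE2 i; rewrite xE1 !mxE => H.
  have gE : g 0 i = v 0 i + (1 - s) / t * (y 0 i - v 0 i).
    have -> : y 0 i = (v 0 i + t * (g 0 i - v 0 i) - s * v 0 i) / (1 - s).
      by rewrite H; field; rewrite subr_eq0 eq_sym.
    by field; rewrite subr_eq0 eq_sym sn1/= gt_eqF; lra.
  by rewrite gE /r; field; rewrite !gt_eqF//; lra.
apply: convex_segment => //; first exact: conv_hull_convex.
rewrite /r divr_ge0 ?(ltW D0) ?mulr_ge0//=.
by rewrite ler_pdivrMr// mul1r; nra.
Qed.

(** The differences of vertices span the orthogonal complement of [e], and each vertex differs from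
    [v] by a direction of aff G plus a multiple of [g0 - v]. Since [v] is orthogonal to the former
    but not to the latter, the multiple vanishes on the cut. *)
Lemma aff_hull_vertex_figure :
  aff_hull G = [set x | dot e x = (1 - k) / 2 /\ dot v x = 1 / 2].
Proof.
apply/seteqP; split=> [x Gx|x [/= ex vx]].
  by split; apply: aff_hull_hyperplane Gx => g Gg; [exact: G_e|exact: G_v].
have [g0 Ng0] := N_ex; have Gg0 := sub_aff_hull (N_G Ng0).
(* The direction space of aff G, encoded as the translations that preserve it. *)
pose D := [set z | forall y, aff_hull G y -> aff_hull G (y + z)].
have DD z1 z2 : D z1 -> D z2 -> D (z1 + z2).
  by move=> D1 D2 y Gy; rewrite addrA; apply: D2; exact: D1.
have DZ t z : D z -> D (t *: z).
  move=> Dz y Gy; have := aff_hull_comb t Gy (Dz _ Gg0) Gg0.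
  by rewrite [g0 + z]addrC addrK.
have DB y z : aff_hull G y -> aff_hull G z -> D (y - z).
  by move=> Gy Gz w Gw; rewrite -[y - z]scale1r; exact: aff_hull_comb.
have Dv z : D z -> dot v z = 0.
  move=> /(_ _ Gg0) /(@aff_hull_hyperplane _ _ G v (1 / 2) G_v) /=.
  by rewrite dotDr (Ng0.2); lra.
pose S := [set z | exists r, D (z - r *: (g0 - v))].
have SD z1 z2 : S z1 -> S z2 -> S (z1 + z2).
  move=> [r1 D1] [r2 D2]; exists (r1 + r2).
  by rewrite scalerDl opprD addrACA; exact: DD.
have SZ t z : S z -> S (t *: z).
  by move=> [r Dr]; exists (t * r); rewrite -scalerA -scalerBr; exact: DZ.
have SN g : N g -> S (g - v).
  move=> Ng; exists 1; rewrite scale1r opprB addrA subrK.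
  by apply: DB => //; exact: sub_aff_hull (N_G Ng).
have SX y : X y -> S (y - v).
  move=> Xy; case: (X_dot Xv Xy) => [<-|vy|vy]; last 2 first.
  - by apply: SN.
  - have [g [h [Xg Xh vg vh gh]]] := X_square Xv Xy vy.
    have -> : y - v = (g - v) + (h - v).
      by have /rowP gh' := gh; apply/rowP => i; have := gh' i; rewrite !mxE; lra.
    by apply: SD; apply: SN.
  by exists 0; rewrite subrr scale0r subrr => w; rewrite addr0.
have [r Dr] : S (x - g0).
  apply: X_span => //; last by rewrite dotDr dotNr ex (X_e Ng0.1) subrr.
  move=> y z Xy Xz; have -> : y - z = (y - v) + (-1) *: (z - v).
    by apply/rowP => i; rewrite !mxE; ring.
  by apply: SD; [|apply: SZ]; exact: SX.
have r0 : r = 0.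
  by have := Dv _ Dr; rewrite !dot_linE vx (Ng0.2) vv; lra.
by have := Dr _ Gg0; rewrite r0 scale0r subr0 addrC subrK.
Qed.

(** * Uniqueness of the second copy of a piece *)

Let km : 1 - k != 0. Proof. by rewrite gt_eqF// subr_gt0. Qed.
Let kp : 1 + k != 0. Proof. by rewrite gt_eqF// addr_gt0. Qed.

(* [b] spans the normal of the linear hyperplane through the vertex figure, so
   that the only isometries that fix the origin and the vertex figure pointwise
   are the identity and the reflection in [b]. *)
Variable b : 'rV[R]_n.
Hypothesis bE : b = e - (1 - k) *: v.

Let eb : dot e b = k * (1 - k) / 2.
Proof. by rewrite bE !dot_linE ee ev; field. Qed.

Let bb : dot b b = (1 - k) / 2.
Proof. by rewrite bE !dot_linE ee ev ve vv; field. Qed.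

Let b0 : b != 0.
Proof.
apply/eqP => bz; move/eqP: bb.
by rewrite bz dot0l eq_sym mulf_eq0 (negPf km) invr_eq0 pnatr_eq0.
Qed.

Let dot_b x : dot e x = (1 - k) / 2 -> dot b x = (1 - k) * (1 / 2 - dot v x).
Proof. by move=> ex; rewrite bE !dot_linE ex; field. Qed.

Let refl_bE x : refl b x = x - (4 * dot b x / (1 - k)) *: b.
Proof.
by rewrite /refl bb (dotC x); congr (_ - _ *: _); field; exact: km.
Qed.

Let refl_b_id x : dot e x = (1 - k) / 2 -> dot v x = 1 / 2 -> refl b x = x.
Proof. by move=> ex vx; apply: refl_id; rewrite dotC dot_b// vx subrr mulr0. Qed.

Let refl_b_G g : G g -> refl b g = g.
Proof. by move=> Gg; apply: refl_b_id; [exact: G_e|exact: G_v]. Qed.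

Let dot_refl_v : dot v (refl b v) = k.
Proof. by rewrite refl_bE !dot_linE (dotC v b) dot_b// vv; field; exact: km. Qed.

(* The part of F above (s = 1) or below (s = -1) the cut through G. *)
Definition piece s Q := [/\ s * s = 1, G `<=` Q, Q `<=` F,
  forall x, Q x -> 0 <= s * (dot v x - 1 / 2) &
  inscribed Q /\ exists q, vertex Q q /\ dot v q != 1 / 2].

(** The part [w'] of [w] normal to the plane of [e] and [v] is a direction of aff G, hence
    orthogonal to [w] and so zero. Vanishing at one point of [G] then fixes the ratio of the two
    remaining coefficients. *)
Lemma orthogonal_vertex_figure w : (forall g, G g -> dot w g = 0) ->
  exists t, w = t *: b.
Proof.
move=> wG; have [g0 Ng0] := N_ex; have Gg0 := N_G Ng0.
have wL x : dot e x = (1 - k) / 2 -> dot v x = 1 / 2 -> dot w x = 0.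
  move=> ex vx; apply: (@aff_hull_hyperplane _ _ G) => //.
  by rewrite aff_hull_vertex_figure.
(* [r] and [s] are the coefficients of the projection of [w] to the plane of [e] and [v], whose Gram
   determinant is (1 - k)(1 + k)/4. *)
pose s := 2 * (dot w v - dot w e) / (1 + k).
pose r := 2 * dot w e / (1 - k) - s.
have [w' w'E] : exists w', w' = w - r *: e - s *: v by eexists.
have w'e : dot w' e = 0.
  by rewrite w'E !dot_linE ee ve /r /s; field; rewrite km kp.
have w'v : dot w' v = 0.
  by rewrite w'E !dot_linE ev vv /r /s; field; rewrite km kp.
have ww' : dot w w' = 0.
  have := wL (g0 + w'); rewrite !dotDr (wG _ Gg0) add0r (dotC e w') w'e.
  by rewrite (dotC v w') w'v !addr0; apply; [exact: G_e|exact: G_v].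
have /dot_eq0 w'0 : dot w' w' = 0.
  by rewrite {1}w'E !dot_linE ww' (dotC e) (dotC v) w'e w'v; ring.
have wE : w = r *: e + s *: v.
  have /rowP h := etrans (esym w'E) w'0.
  by apply/rowP => i; have := h i; rewrite !mxE; lra.
exists r; have := wG _ Gg0; rewrite wE !dot_linE (G_e Gg0) (G_v Gg0) => sE.
have -> : s = - (1 - k) * r by lra.
by rewrite bE; apply/rowP => i; rewrite !mxE; ring.
Qed.

Lemma aff_hull_off_cut A q : G `<=` A -> A `<=` F -> A q -> dot v q != 1 / 2 ->
  aff_hull A = [set x | dot e x = (1 - k) / 2].
Proof.
move=> GA AF Aq vq; apply/seteqP; split=> [|x /= ex].
  by apply: aff_hull_hyperplane => x /AF/F_e.
have [g0 Ng0] := N_ex; have Gg0 := N_G Ng0.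
(* Chosen so that subtracting [r] times [q - g0] from [x] lands in aff G. *)
pose r := (dot v x - 1 / 2) / (dot v q - 1 / 2).
have vq0 : dot v q - 1 / 2 != 0 by rewrite subr_eq0.
rewrite -[x](subrK (r *: (q - g0))).
apply: aff_hull_comb; [|exact: sub_aff_hull|exact/sub_aff_hull/GA].
apply: (aff_hull_mono GA); rewrite aff_hull_vertex_figure; split.
  by rewrite /= !dot_linE ex (F_e (AF _ Aq)) (G_e Gg0); ring.
have rE : r * (dot v q - 1 / 2) = dot v x - 1 / 2 by rewrite divfK.
by rewrite /= !dot_linE (G_v Gg0); lra.
Qed.

Lemma piece_point s Q : piece s Q ->
  exists q, [/\ vertex Q q, Q q, dot q q = 1 & dot v q != 1 / 2].
Proof.
move=> [_ _ _ _ [iQ [q [Vq vq]]]]; exists q; split=> //; last exact: iQ.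
by apply: (face_sub Vq).
Qed.

Lemma aff_hull_piece s Q : piece s Q ->
  aff_hull Q = [set x | dot e x = (1 - k) / 2].
Proof.
move=> pQ; have [q [_ Qq _ vq]] := piece_point pQ.
by have [_ GQ QF _ _] := pQ; apply: aff_hull_off_cut vq.
Qed.

(** The fixed points span aff F, so the displacement of [x] is normal to aff F, a multiple of [e].
    It vanishes because [x] keeps its distance to [g0], which lies at the same height along [e]. *)
Let isometry_fix f Q s q : Defs.isometry f -> (forall g, G g -> f g = g) ->
  piece s Q -> Q q -> dot v q != 1 / 2 -> f q = q -> forall x, Q x -> f x = x.
Proof.
move=> If fG [_ GQ QF _ _] Qq vq fq x Qx; have [g0 /N_G Gg0] := N_ex.
have [w wE] : exists w, w = f x - x by exists (f x - x).
have wP p : f p = p -> dot w p = dot w g0.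
  move=> fp; have := isometry_dot2 x p g0 If.
  by rewrite (fG _ Gg0) fp wE !dot_linE; lra.
have wL y : dot e y = (1 - k) / 2 -> dot w y = dot w g0.
  move=> ey; apply: (@aff_hull_hyperplane _ _ (q |` G)).
    by move=> z [->|Gz]; apply: wP => //; exact: fG.
  suff -> : aff_hull (q |` G) = [set x | dot e x = (1 - k) / 2] by [].
  apply: aff_hull_off_cut vq; [by move=> z; right| |by left].
  by move=> z [->|/GQ/QF//]; exact: QF.
have [w' w'E] : exists w', w' = w - (2 * dot w e / (1 - k)) *: e by eexists.
have w'e : dot w' e = 0 by rewrite w'E !dot_linE ee; field.
have ww' : dot w w' = 0.
  have := wL (g0 + w'); rewrite !dotDr (dotC e w') w'e addr0 (G_e Gg0).
  by move=> /(_ erefl); lra.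
have /dot_eq0 w'0 : dot w' w' = 0.
  by rewrite {1}w'E !dot_linE ww' (dotC e) w'e; ring.
pose m := 2 * dot w e / (1 - k).
have wme : w = m *: e.
  have /rowP h := etrans (esym w'E) w'0.
  by apply/rowP => i; have := h i; rewrite !mxE -/m; lra.
have fxE : f x = x + m *: e by rewrite -wme wE addrC subrK.
have := isometry_dot x g0 If; rewrite (fG _ Gg0) fxE !dot_linE ee.
have := F_e (QF _ Qx); have := G_e Gg0; rewrite (dotC x e) (dotC g0 e).
move=> -> -> h; have : m ^+ 2 * ((1 - k) / 2) = 0 by lra.
have km2 : (1 - k) / 2 != 0 by rewrite mulf_neq0 ?invr_eq0 ?pnatr_eq0.
move/eqP; rewrite mulf_eq0 (negPf km2) orbF sqrf_eq0 => /eqP m0.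
by rewrite m0 scale0r addr0.
Qed.

Lemma isometry_piece f Q s : Defs.isometry f -> (forall g, G g -> f g = g) ->
  piece s Q -> inscribed (f @` Q) -> f @` Q = Q \/ f @` Q = refl b @` Q.
Proof.
move=> If fG pQ ifQ; have [q [Vq Qq qq vq]] := piece_point pQ.
have [_ GQ QF _ _] := pQ.
have fqq := ifQ _ (isometry_vertex If Vq).
(* Both [q] and [f q] are unit vectors at equal distance from each point of [G]. *)
have [t fqE] : exists t, f q - q = t *: b.
  apply: orthogonal_vertex_figure => g Gg.
  have := isometry_dot q g If; rewrite (fG _ Gg) !dot_linE fqq qq.
  by rewrite (dotC g (f q)) (dotC g q); lra.
have {}fqE : f q = q + t *: b by rewrite -fqE addrC subrK.
have [t0|tn0] := eqVneq t 0.
  have fq : f q = q by rewrite fqE t0 scale0r addr0.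
  left; have fx := isometry_fix If fG pQ Qq vq fq.
  by apply/seteqP; split=> x; [move=> [y Qy <-]; rewrite fx|exists x; rewrite ?fx].
right.
(* The nonzero root of the quadratic equation saying that [q + t *: b] is a unit vector. *)
have tE : t = - (4 * dot b q / (1 - k)).
  have h : t * (2 * dot b q + t * ((1 - k) / 2)) = 0.
    by move: fqq; rewrite fqE !dot_linE qq bb (dotC q b); lra.
  move/eqP: h; rewrite mulf_eq0 (negPf tn0)/= => /eqP h.
  have -> : dot b q = - t * ((1 - k) / 4) by lra.
  by field; exact: km.
have fq : f q = refl b q by rewrite fqE tE refl_bE scaleNr.
(* Composing with the reflection reduces this case to an isometry that fixes [q] too. *)
have Isf : Defs.isometry (refl b \o f).
  by move=> x y /=; rewrite isometry_refl.
have sfG g : G g -> (refl b \o f) g = g.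
  by move=> Gg /=; rewrite (fG _ Gg) refl_b_G.
have sfq : (refl b \o f) q = q by rewrite /= fq reflK.
have fx := isometry_fix Isf sfG pQ Qq vq sfq.
have {}fx x : Q x -> f x = refl b x by move=> /fx {2}<- /=; rewrite reflK.
by apply/seteqP; split=> _ [x Qx <-]; exists x; rewrite ?fx//.
Qed.

Lemma joined_piece s Q Q' : piece s Q ->
  joined_along G Q Q' <-> Q' = refl b @` Q.
Proof.
move=> pQ; have [q [Vq Qq qq vq]] := piece_point pQ.
have [_ GQ QF _ [iQ _]] := pQ; have Ib := isometry_refl b0.
split=> [[QQ' [_ iQ'] _ [f [If fQ fG]]]|->].
  by have [] := isometry_piece If fG pQ; rewrite fQ.
split.
(* Since [k] is positive, [b] is not orthogonal to [e], so the mirror image of [q] leaves the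
   hyperplane of F. *)
- move=> QE; have : Q (refl b q) by rewrite -QE; exists q.
  have bq0 : dot b q != 0.
    by rewrite dot_b ?(F_e (QF _ Qq))// mulf_neq0// subr_eq0 eq_sym.
  move=> /QF/F_e; rewrite refl_bE !dot_linE eb (F_e (QF _ Qq)).
  have -> : 4 * dot b q / (1 - k) * (k * (1 - k) / 2) = k * (2 * dot b q).
    by field; exact: km.
  move=> h; have /eqP : k * (2 * dot b q) = 0 by lra.
  by rewrite !mulf_eq0 (gt_eqF k0) pnatr_eq0 (negPf bq0).
- split=> // y Vy; have := isometry_vertex Ib Vy.
  by rewrite refl_imageK// => /iQ; rewrite dot_refl.
- by move=> g Gg; split; [exact: GQ|exists g; [exact: GQ|exact: refl_b_G]].
- by exists (refl b); split=> // g Gg; exact: refl_b_G.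
Qed.

Lemma piece_pyramid : piece 1 (pyramid v G).
Proof.
have GP : G `<=` pyramid v G by move=> g Gg; apply: sub_conv_hull; right.
split=> //; first by rewrite mulr1.
- by rewrite pyramid_cut => x [].
- by rewrite pyramid_cut => x [_ vx]; rewrite mul1r subr_ge0.
split.
  move=> x /(vertex_extreme (@conv_hull_convex _ _ _)) Ex.
  have [->//|Gx] := extreme_conv_hull Ex.
  have : extreme G x by exact: extreme_sub Ex.
  by rewrite vertex_figureE => /extreme_conv_hull[/X_unit].
exists v; split; last by rewrite vv gt_eqF//; lra.
apply: (@face_conv_hull _ _ _ _ v 1); first exact: convex_set1.
- by move=> _ ->; apply: sub_conv_hull; left.
- by move=> _ ->.
- by move=> x [->|Gx]; [left|right; rewrite (G_v Gx); lra].
Qed.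

Lemma piece_diminished_cell : piece (-1) (diminished_cell F v).
Proof.
split.
- by rewrite mulrNN mulr1.
- rewrite diminished_cell_cut => g Gg.
  by split; [exact: G_F|rewrite (G_v Gg)].
- by rewrite diminished_cell_cut => x [].
- by rewrite diminished_cell_cut => x [_ vx]; lra.
rewrite diminished_cell_conv; split.
  by move=> x /(vertex_extreme (@conv_hull_convex _ _ _))/extreme_conv_hull[/X_unit].
exists y0; split; last by rewrite vy0 lt_eqF//; lra.
have Yy0 : Y y0 by split=> //; rewrite vy0; lra.
apply: (@face_conv_hull _ _ _ _ y0 1); first exact: convex_set1.
- by move=> _ ->; exact: sub_conv_hull.
- by move=> _ ->; exact: X_unit.
- by move=> x [Xx _]; case: (X_le Xy0 Xx) => [->|xy]; [left|right; lra].
Qed.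

(** * The turn about the vertex figure and the dihedral angle *)

Lemma has_dim_vertex_figure : has_dim (aff_hull G) n.-2.
Proof.
have [g0 /N_G Gg0] := N_ex.
apply: (@has_dim_set _ _ (kermx (col_mx e v)^T) g0).
  rewrite mxrank_ker mxrank_tr -subn2; congr (_ - _)%N; apply/eqP.
  change (row_free (col_mx e v)); rewrite -kermx_eq0; apply/rowV0P => u.
  move=> /sub_kermxP; rewrite -[u]hsubmxK mul_row_col.
  rewrite [lsubmx u]mx11_scalar [rsubmx u]mx11_scalar !mul_scalar_mx.
  set s := lsubmx u 0 0; set t := rsubmx u 0 0 => uE.
  have := congr1 (dot e) uE; have := congr1 (dot v) uE.
  rewrite !dot_linE !dot0r ee ev ve vv => h1 h2.
  have tE : t = - s * ((1 - k) / 2) by lra.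
  have h : s * ((1 - k) * (1 + k)) = 0 by move: h2; rewrite tE; lra.
  have s0 : s = 0.
    by apply/eqP; move/eqP: h; rewrite !mulf_eq0 (negPf km) (negPf kp) !orbF.
  have t0 : t = 0 by move: h1; rewrite s0; lra.
  by rewrite s0 t0 !raddf0 row_mx0.
have -> : aff_hull (aff_hull G) = aff_hull G.
  apply/seteqP; split; last exact: sub_aff_hull.
  rewrite [X in _ `<=` X]aff_hull_vertex_figure => x Gx.
  by split; apply: aff_hull_hyperplane Gx => y;
    rewrite aff_hull_vertex_figure => -[].
rewrite aff_hull_vertex_figure; apply/seteqP.
have mul_dot (x y : 'rV[R]_n) : x *m y^T = (dot x y)%:M by exact: mx11_scalar.
have [eg vg] := (G_e Gg0, G_v Gg0).
split=> x /=.
  move=> [ex vx]; apply/sub_kermxP; rewrite tr_col_mx mul_mx_row !mul_dot.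
  rewrite (dotC _ e) (dotC _ v) !dot_linE ex vx eg vg !subrr.
  by rewrite !raddf0 row_mx0.
move=> /sub_kermxP; rewrite tr_col_mx mul_mx_row !mul_dot -row_mx0.
move=> /eq_row_mx[/matrixP/(_ 0 0) + /matrixP/(_ 0 0)].
by rewrite !mxE/= !mulr1n (dotC _ e) (dotC _ v) !dot_linE eg vg; lra.
Qed.

(** [rho] is the distance from [e] to the vertices, the circumradius of F; [d] is the norm of [e],
    the distance from the origin to aff F. *)
Let rho := Num.sqrt ((1 + k) / 2).
Let d := Num.sqrt ((1 - k) / 2).

Let rho2 : rho * rho = (1 + k) / 2.
Proof. by rewrite -expr2 sqr_sqrtr// divr_ge0// addr_ge0// ltW. Qed.

Let d2 : d * d = (1 - k) / 2.
Proof. by rewrite -expr2 sqr_sqrtr// divr_ge0// subr_ge0 ltW. Qed.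

Let rho0 : 0 < rho.
Proof. by rewrite sqrtr_gt0 divr_gt0// addr_gt0. Qed.

Let d0 : 0 < d.
Proof. by rewrite sqrtr_gt0 divr_gt0// subr_gt0. Qed.

Let rhoV2 : rho^-1 * rho^-1 = 2 / (1 + k).
Proof. by rewrite -invfM rho2 invf_div. Qed.

Let dV2 : d^-1 * d^-1 = 2 / (1 - k).
Proof. by rewrite -invfM d2 invf_div. Qed.

Let cosE (beta : R) : sin beta = k -> 0 <= beta < pi / 2 -> cos beta = 2 * rho * d.
Proof.
move=> sb /andP[b_ge0 b_lt]; apply/eqP; rewrite -(@eqrXn2 _ 2)//.
- have -> : (2 * rho * d) ^+ 2 = 4 * (rho * rho) * (d * d) by ring.
  by rewrite cos2sin2 sb rho2 d2; apply/eqP; field.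
- apply: cos_ge0_pihalf; rewrite (ltW b_lt) andbT; apply: le_trans b_ge0.
  by rewrite oppr_le0 divr_ge0// pi_ge0.
- by rewrite !mulr_ge0// ltW.
Qed.

(** The reflection [tau] of aff F in the cut preserves aff F, and following it by the reflection in
    [b] agrees on aff F with a turn about aff G. So the turn and the reflection in [b] give aff F
    the same image. *)
Lemma refl_turn (beta : R) : sin beta = k -> 0 <= beta < pi / 2 ->
  exists f, turn_about (aff_hull G) (2 * beta) f /\
    refl b @` [set x | dot e x = (1 - k) / 2] =
    f @` [set x | dot e x = (1 - k) / 2].
Proof.
move=> sb betaI; have cb := cosE sb betaI.
have cos2 : cos (2 * beta) - 1 = - (2 * k ^+ 2).
  by rewrite mulr_natl cos_mulr2n cos2sin2 sb; ring.
have sin2 : sin (2 * beta) = 4 * k * rho * d.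
  by rewrite mulr_natl sin_mulr2n cb sb; ring.
have [g0 /N_G Gg0] := N_ex; have [eg vg] := (G_e Gg0, G_v Gg0).
(* An orthonormal basis of the plane normal to aff G; the minus sign in [m] orients it so that the
   angle is [2 * beta], not its negative. *)
pose u := rho^-1 *: (v - e); pose m := (- d^-1) *: e.
pose f x := x + ((cos (2 * beta) - 1) * dot u (x - g0)
                 - sin (2 * beta) * dot m (x - g0)) *: u
              + (sin (2 * beta) * dot u (x - g0)
                 + (cos (2 * beta) - 1) * dot m (x - g0)) *: m.
exists f; split.
  split; first exact: has_dim_vertex_figure.
  exists g0, u, m; split=> //.
  - exact: sub_aff_hull.
  - split.
    + rewrite /u !dot_linE ev ve ee vv -mulrBr mulrA rhoV2.
      by field; exact: kp.
    + rewrite /m !dot_linE ee mulrA mulrNN dV2; field.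
      exact: km.
    + by rewrite /u /m !dot_linE ee ve; ring.
  - rewrite aff_hull_vertex_figure => x [ex vx].
    by rewrite /u /m !dot_linE ex vx eg vg; split; ring.
pose tau x := x - (4 * (dot v x - 1 / 2) / (1 + k)) *: (v - e).
have tau_e x : dot e x = (1 - k) / 2 -> dot e (tau x) = (1 - k) / 2.
  by move=> ex; rewrite /tau !dot_linE ex ev ee subrr mulr0 subr0.
have tau_v x : dot v (tau x) = 1 - dot v x.
  by rewrite /tau !dot_linE vv ve; field; exact: kp.
have tauK x : tau (tau x) = x.
  rewrite {1}/tau tau_v; apply/rowP => i; rewrite /tau !mxE; field; exact: kp.
have fE x : dot e x = (1 - k) / 2 -> f x = refl b (tau x).
  move=> ex.
  have -> : f x = x + (- (4 * k ^+ 2 * (dot v x - 1 / 2) / (1 + k))) *: (v - e)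
                    + (- (4 * k * (dot v x - 1 / 2))) *: e.
    rewrite /f cos2 sin2.
    have -> : dot m (x - g0) = 0 by rewrite /m !dot_linE ex eg; ring.
    have -> : dot u (x - g0) = rho^-1 * (dot v x - 1 / 2).
      by rewrite /u !dot_linE ex eg vg; ring.
    rewrite /u /m !scalerA !mulr0 subr0 addr0.
    congr (_ + _ *: _ + _ *: _).
      transitivity (- (2 * k ^+ 2) * (dot v x - 1 / 2) * (rho^-1 * rho^-1)).
        by ring.
      by rewrite rhoV2; field; exact: kp.
    by field; rewrite !gt_eqF.
  rewrite refl_bE dot_b ?tau_e// tau_v /tau bE.
  by apply/rowP => i; rewrite !mxE; field; rewrite km kp.
apply/seteqP; split=> _ [x /= ex <-].
  exists (tau x); first exact: tau_e.
  by rewrite fE ?tauK//; exact: tau_e.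
by exists (tau x); [exact: tau_e|rewrite fE].
Qed.

(** The conormal of the piece is the unit vector along [v - e], with sign [s]; the reflection
    carries it to the conormal of the copy. As [s * s = 1], the angle is the same for both kinds of
    piece. *)
Let dihedral s Q : piece s Q ->
  dihedral_angle G Q (refl b @` Q) (acos (2 * k ^+ 2 - 1)).
Proof.
move=> pQ; have [ss GQ QF sQ _] := pQ; have QE := aff_hull_piece pQ.
have [w wE] : exists w, w = (s * rho^-1) *: (v - e) by eexists.
have wv x : dot e x = (1 - k) / 2 -> dot w x = s * rho^-1 * (dot v x - (1 - k) / 2).
  by move=> ex; rewrite wE !dot_linE ex.
have ew : dot e w = 0 by rewrite wE !dot_linE ev ee; ring.
have sr2 : (s * rho^-1) * (s * rho^-1) = 2 / (1 + k).
  by rewrite mulrACA ss mul1r rhoV2.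
have ww : dot w w = 1.
  by rewrite wE !dot_linE ev ve ee vv -mulrBr mulrA sr2; field; exact: kp.
exists w, (refl b w); split.
- split=> //.
  + by move=> g Gg; rewrite QE /= dotDr ew addr0 (G_e Gg).
  + move=> g h Gg Gh; rewrite dotDr dotNr !wv; try exact: G_e.
    by rewrite (G_v Gg) (G_v Gh) subrr.
  + move=> x g Qx Gg; rewrite dotDr dotNr !wv ?(G_e Gg) ?(F_e (QF _ Qx))//.
    rewrite (G_v Gg) -mulrBr opprB addrA subrK mulrAC.
    by rewrite mulr_ge0 ?invr_ge0 ?(ltW rho0)//; exact: sQ.
- split.
  + by rewrite dot_refl.
  + move=> g Gg; rewrite aff_hull_refl// QE -{1}(refl_b_G Gg) -reflD.
    by exists (g + w) => //=; rewrite dotDr ew addr0 (G_e Gg).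
  + move=> g h Gg Gh; rewrite -{1}(refl_b_G Gg) -{1}(refl_b_G Gh) -reflB dot_refl//.
    by rewrite dotDr dotNr !wv ?(G_v Gg) ?(G_v Gh) ?subrr//; exact: G_e.
  + move=> _ g [x Qx <-] Gg; rewrite -{1}(refl_b_G Gg) -reflB dot_refl//.
    rewrite dotDr dotNr !wv ?(G_e Gg) ?(F_e (QF _ Qx))//.
    rewrite (G_v Gg) -mulrBr opprB addrA subrK mulrAC.
    by rewrite mulr_ge0 ?invr_ge0 ?(ltW rho0)//; exact: sQ.
congr acos; rewrite refl_bE !dot_linE ww (dotC b).
have -> : dot w b = - (s * rho^-1) * ((1 - k) * (1 + k) / 2).
  by rewrite bE wE !dot_linE ee ev ve vv; field; rewrite gt_eqF.
have -> : 1 - 4 * (- (s / rho) * ((1 - k) * (1 + k) / 2)) / (1 - k) *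
    (- (s / rho) * ((1 - k) * (1 + k) / 2)) =
    1 - (s / rho * (s / rho)) * (1 - k) * (1 + k) ^+ 2.
  by field; rewrite km gt_eqF.
by rewrite sr2; field; exact: kp.
Qed.

Lemma piece_foldsP s Q (beta : R) : piece s Q -> sin beta = k ->
  0 <= beta < pi / 2 -> piece_folds G Q (2 * beta).
Proof.
move=> pQ sb betaI; split; first by exists (refl b @` Q); apply/(joined_piece _ pQ).
move=> _ /(joined_piece _ pQ) ->; split.
  have [f [tf fE]] := refl_turn sb betaI; exists f; split=> //.
  by rewrite aff_hull_refl// (aff_hull_piece pQ).
exists (acos (2 * k ^+ 2 - 1)); split; first exact: dihedral pQ.
have -> : 2 * k ^+ 2 - 1 = cos (pi - 2 * beta).
  rewrite -[pi - _]opprB cosN cosB cospi sinpi [2 * beta]mulr_natl.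
  by rewrite cos_mulr2n cos2sin2 sb; ring.
have /andP[be0 bepi] := betaI.
rewrite cosK; last by rewrite in_itv/=; apply/andP; split; lra.
by rewrite addrAC subrr add0r normrN ger0_norm//; lra.
Qed.

Lemma split_foldsP (beta : R) : sin beta = k -> 0 <= beta < pi / 2 ->
  split_folds F v (2 * beta).
Proof.
by move=> sb bI; split; [apply: piece_foldsP piece_pyramid _ _|
                         apply: piece_foldsP piece_diminished_cell _ _].
Qed.

Lemma reflex_ridgeP v' : reflex_ridge F v v' <-> v' = refl b v.
Proof.
rewrite /reflex_ridge -/G (joined_piece _ piece_pyramid).
split=> [pE|->]; last first.
  rewrite -conv_hull_refl//; congr conv_hull; apply/seteqP; split=> x.
    by move=> [->|Gx]; [exists v => //; left|exists x; [right|exact: refl_b_G]].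
  by move=> [y [->|Gy] <-]; [left|right; rewrite refl_b_G].
have Vv : vertex (pyramid v G) v.
  apply: (@face_conv_hull _ _ _ _ v 1); first exact: convex_set1.
  - by move=> _ ->; apply: sub_conv_hull; left.
  - by move=> _ ->.
  - by move=> x [->|Gx]; [left|right; rewrite (G_v Gx); lra].
have := isometry_vertex (isometry_refl b0) Vv; rewrite -pE.
move=> /(vertex_extreme (@conv_hull_convex _ _ _))/extreme_conv_hull[->//|Gv].
(* If the mirror image of [v] were in [G], it would be fixed by the reflection and [v] itself would
   lie on the cut. *)
have vE : refl b v = v by rewrite -[LHS](refl_b_G Gv) reflK.
have := G_v Gv; rewrite vE vv => /eqP; rewrite eq_sym lt_eqF//; lra.
Qed.

Lemma dot_reflex_ridge v' : reflex_ridge F v v' -> dot v v' = k.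
Proof. by move=> /reflex_ridgeP ->. Qed.

End Fold.

(** * The vertices of k_21 *)

Section OrbitCoordinates.
Variable k : nat.
Implicit Types (c d : seq int).

(** Integer entries and [nat] indices make the conditions below computable. *)
Definition int_cartan (i j : nat) : int :=
  if i == j then 2
  else let arc (a b : nat) :=
         ((a.+1 == b) && (b < k.+3)%N) || ((a == 2) && (b == k.+3)) in
       if arc i j || arc j i then -1 else 0.

(* [bigop] is locked, so it would not reduce in [gosset_check]. *)
Definition node_sum (f : nat -> int) : int :=
  foldr (fun i s => f i + s) 0 (iota 0 k.+4).

(* The sequence c stands for the point omega - t * \sum_i c_i alpha_i of the
   orbit, where t is the inner product of omega with alpha_(k+2); the inner
   product of this point with alpha_j is t times [label c j]. *)
Definition label c (j : nat) : int :=
  (j == k.+2)%:Z - node_sum (fun i => c`_i * int_cartan i j).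

Definition reflect_coord c (j : nat) : seq int :=
  mkseq (fun i => c`_i + (if i == j then label c j else 0)) k.+4.

(** Times t^2, this is the squared distance from omega to the orbit point with coordinates [c]: 2
    for an edge, 4 for the diagonal of a square. *)
Definition norm2 c : int :=
  node_sum (fun i => c`_i * node_sum (fun j => c`_j * int_cartan j i)).

Definition sub_coord c d : seq int := mkseq (fun i => c`_i - d`_i) k.+4.

Definition grow (L : seq (seq int)) : seq (seq int) :=
  let new := flatten [seq map (reflect_coord c) (iota 0 k.+4) | c <- L] in
  L ++ undup [seq c <- new | c \notin L].

(* Sixteen rounds exhaust the longest orbit, that of the vertices of 2_21. *)
Definition orbit_coords : seq (seq int) := iter 16 grow [:: nseq k.+4 0].

(* 5 - k times the row k+2 of the inverse Cartan matrix. *)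
Definition weight_coords : seq int := take k.+3 [:: 2; 4; 6; 5; 4] ++ [:: 3].

(** The third case makes omega and the point of [c] opposite in a square whose other diagonal joins
    the points of [d] and [c - d]. *)
Definition square_check L c : bool :=
  [|| c == nseq k.+4 0, norm2 c == 2
    | (norm2 c == 4) && has (fun d =>
        [&& norm2 d == 2, norm2 (sub_coord c d) == 2
          & sub_coord c d \in L]) L].

(** Closure under reflections makes the list the whole orbit; the labels provide, for each mirror, a
    vertex off it; the weight conditions give the circumradius. *)
Definition gosset_check L : bool :=
  [&& all (fun c => all (fun j => reflect_coord c j \in L) (iota 0 k.+4)) L,
      all (square_check L) L,
      has (fun c => norm2 c == 4) L,
      all (fun j => has (fun c => label c j != 0) L) (iota 0 k.+4),
      all (fun j => node_sum (fun i => weight_coords`_i * int_cartan i j)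
                    == (if j == k.+2 then 5 - k%:Z else 0)) (iota 0 k.+4)
    & weight_coords`_k.+2 == 6 - k%:Z].

Lemma gosset_checkE L : gosset_check L ->
  [/\ forall c j, c \in L -> (j < k.+4)%N -> reflect_coord c j \in L,
      forall c, c \in L -> square_check L c,
      exists2 c, c \in L & norm2 c = 4,
      forall j, (j < k.+4)%N -> exists2 c, c \in L & label c j != 0 &
      (forall j, (j < k.+4)%N ->
        node_sum (fun i => weight_coords`_i * int_cartan i j) =
        if j == k.+2 then 5 - k%:Z else 0) /\
      weight_coords`_k.+2 = 6 - k%:Z].
Proof.
have iotaP j : (j < k.+4)%N -> j \in iota 0 k.+4 by rewrite mem_iota.
move=> /and5P[/allP h1 /allP h2 /hasP[c Lc /eqP h3] /allP h4].
move=> /andP[/allP h5 /eqP h6].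
split=> //.
- by move=> d j /h1/allP h /iotaP/h.
- by exists c.
- by move=> j /iotaP/h4/hasP[d Ld ld]; exists d.
- by split=> // j /iotaP/h5/eqP.
Qed.

Lemma node_sumE f : node_sum f = \sum_(i < k.+4) f i.
Proof.
by rewrite /node_sum -(big_mkord xpredT) unlock /reducebig /index_iota subn0.
Qed.

End OrbitCoordinates.

Lemma gosset_checkP k : (k < 3)%N -> gosset_check k (orbit_coords k).
Proof. by case: k => [|[|[|]]]// _; vm_compute. Qed.

(** * Distances and circumradius of the orbit *)

Section GossetOrbit.
Context {R : realType} {n k : nat}.
Variables (alpha : 'I_k.+4 -> 'rV[R]_n) (omega center : 'rV[R]_n) (t : R).
Hypothesis k_lt3 : (k < 3)%N.
Hypothesis alphaE : forall i j, dot (alpha i) (alpha j) = E_cartan R i j.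
Hypothesis omegaE : forall i, dot omega (alpha i) = if val i == k.+2 then t else 0.
Hypothesis t0 : 0 < t.
Implicit Types (c d : seq int) (x y : 'rV[R]_n).

Let E_cartanE (i j : 'I_k.+4) : E_cartan R i j = (int_cartan k i j)%:~R.
Proof.
rewrite /E_cartan /int_cartan /E_adj -val_eqE /=.
by case: ifP => // _; case: ifP => // _; rewrite rmorphN1.
Qed.

Let sqr_alpha i : dot (alpha i) (alpha i) = 2.
Proof. by rewrite alphaE /E_cartan eqxx. Qed.

Let alpha0 i : alpha i != 0.
Proof.
apply/eqP => a0; have /eqP := sqr_alpha i.
by rewrite a0 dot0l eq_sym pnatr_eq0.
Qed.

Let refl_alphaE i x : refl (alpha i) x = x - dot x (alpha i) *: alpha i.
Proof. by rewrite /refl sqr_alpha; congr (_ - _ *: _); field. Qed.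

Let lin c : 'rV[R]_n := \sum_(i < k.+4) (c`_i)%:~R *: alpha i.

Let dot_lin c j : dot (lin c) (alpha j) =
  (node_sum k (fun i => c`_i * int_cartan k i j))%:~R.
Proof.
rewrite /lin dot_suml node_sumE rmorph_sum; apply: eq_bigr => i _.
by rewrite dotZl alphaE E_cartanE rmorphM.
Qed.

Let norm2_lin c : dot (lin c) (lin c) = (norm2 k c)%:~R.
Proof.
rewrite {2}/lin dot_sumr /norm2 node_sumE rmorph_sum; apply: eq_bigr => i _.
by rewrite dotZr dot_lin rmorphM.
Qed.

Let pt c : 'rV[R]_n := omega - t *: lin c.

Let dot_pt c j : dot (pt c) (alpha j) = t * (label k c j)%:~R.
Proof.
rewrite /pt dotDl dotNl dotZl dot_lin omegaE /label rmorphB mulrBr/=.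
by case: eqP => _; rewrite ?mulr1 ?mulr0.
Qed.

Let refl_pt c j : refl (alpha j) (pt c) = pt (reflect_coord k c j).
Proof.
rewrite refl_alphaE dot_pt /pt -addrA -opprD -scalerA -scalerDr.
congr (_ - _ *: _); rewrite /lin (bigD1 j)//= [RHS](bigD1 j)//=.
rewrite nth_mkseq// eqxx (intrD R c`_j) scalerDl addrAC; congr (_ + _).
apply: eq_bigr => i ij; rewrite nth_mkseq//.
by rewrite ifN ?addr0// ; apply: contra ij => /eqP/val_inj->.
Qed.

Let pt0 : pt (nseq k.+4 0) = omega.
Proof.
rewrite /pt /lin big1 ?scaler0 ?subr0// => i _.
by rewrite nth_nseq if_same scale0r.
Qed.

Let orbit := refl_orbit alpha omega.

Let pt_orbit c : c \in orbit_coords k -> orbit (pt c).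
Proof.
rewrite /orbit_coords; move: 16%N => m; elim: m c => [|m IH] c.
  by rewrite inE => /eqP->; rewrite pt0; exact: refl_orbit_base.
rewrite iterS mem_cat mem_undup mem_filter.
move=> /orP[/IH//|/andP[_ /flattenP[_ /mapP[d /IH od ->]]]].
case/mapP => j; rewrite mem_iota add0n => /= jk ->.
by rewrite (_ : j = Ordinal jk)// -refl_pt; exact: refl_orbit_step.
Qed.

Let orbit_pt x : orbit x -> exists2 c, c \in orbit_coords k & x = pt c.
Proof.
elim=> [|i _ _ [c Lc ->]].
  exists (nseq k.+4 0); rewrite ?pt0// /orbit_coords; elim: 16%N => [|m IH].
    by rewrite inE.
  by rewrite iterS mem_cat IH.
exists (reflect_coord k c i); last by rewrite refl_pt.
by have [h _ _ _ _] := gosset_checkE (gosset_checkP k_lt3); apply: h.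
Qed.

(* By the symmetry of the orbit, properties of pairs of vertices only have to be
   checked when one of the vertices is omega. *)
Lemma orbit_dist x y : orbit x -> orbit y ->
  [\/ x = y, dot (x - y) (x - y) = 2 * t ^+ 2 |
      dot (x - y) (x - y) = 4 * t ^+ 2 /\
      exists g h, [/\ orbit g, orbit h, dot (x - g) (x - g) = 2 * t ^+ 2,
        dot (x - h) (x - h) = 2 * t ^+ 2 & g + h = x + y]].
Proof.
move=> ox; elim: ox y => [|i {}x ox IH] y oy; last first.
  have oy' := refl_orbit_step i oy.
  have ryy : refl (alpha i) (refl (alpha i) y) = y by rewrite reflK.
  rewrite -ryy -reflB dot_refl//.
  case: (IH _ oy') => [<-|d2|]; [by constructor 1|by constructor 2|].
  move=> [d4 [g [h [og oh xg xh gh]]]]; constructor 3; split=> //.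
  exists (refl (alpha i) g), (refl (alpha i) h); split.
  - exact: refl_orbit_step.
  - exact: refl_orbit_step.
  - by rewrite -reflB dot_refl.
  - by rewrite -reflB dot_refl.
  - by rewrite -!reflD gh.
have [c Lc ->] := orbit_pt oy.
have dist d : dot (omega - pt d) (omega - pt d) = (norm2 k d)%:~R * t ^+ 2.
  by rewrite opprD opprK addrA subrr add0r dotZl dotZr norm2_lin; ring.
have [_ /(_ _ Lc) sq _ _ _] := gosset_checkE (gosset_checkP k_lt3).
case/or3P: sq => [/eqP->|/eqP nc|/andP[/eqP nc /hasP[d Ld
  /and3P[/eqP nd /eqP nh Lh]]]].
- by constructor 1; rewrite pt0.
- by constructor 2; rewrite dist nc.
constructor 3; rewrite dist nc; split=> //; exists (pt d), (pt (sub_coord k c d)).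
split; rewrite ?dist ?nd ?nh//; try exact: pt_orbit.
rewrite /pt addrACA -opprD -scalerDr -addrA; congr (_ + (_ - _ *: _)).
rewrite /lin -big_split/=; apply: eq_bigr => i _.
by rewrite nth_mkseq// -scalerDl -rmorphD addrC subrK.
Qed.

Lemma orbit_far x : orbit x ->
  exists2 y, orbit y & dot (x - y) (x - y) = 4 * t ^+ 2.
Proof.
elim=> [|i {}x ox [y oy xy]].
  have [_ _ [c Lc nc] _ _] := gosset_checkE (gosset_checkP k_lt3).
  exists (pt c); first exact: pt_orbit.
  by rewrite opprD opprK addrA subrr add0r dotZl dotZr norm2_lin nc; ring.
exists (refl (alpha i) y); first exact: refl_orbit_step.
by rewrite -reflB dot_refl.
Qed.

Lemma orbit_norm x : orbit x -> dot x x = dot omega omega.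
Proof. by elim=> // i {}x _ <-; rewrite dot_refl. Qed.

(* [e] is the foot of the perpendicular from the origin to the affine hull of the
   polytope. *)
Lemma orbit_axis : (forall x, orbit x -> dot (center + x) (center + x) = 1) ->
  exists e, (forall x, orbit x -> dot e (center + x) = dot e e) /\
    dot e e = 1 - t ^+ 2 * ((6%:R - k%:R) / (5%:R - k%:R)).
Proof.
move=> unit.
have [_ _ _ lab [wt wk]] := gosset_checkE (gosset_checkP k_lt3).
have center_alpha i : dot center (alpha i) = 0.
  have [c Lc lc] := lab _ (ltn_ord i).
  have oc := pt_orbit Lc; apply: (@refl_center _ _ _ _ (pt c)).
    by rewrite unit ?unit//; exact: refl_orbit_step.
  by rewrite dot_pt; apply: mulf_neq0; [rewrite gt_eqF|rewrite intr_eq0].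
have k5 : (5%:R - k%:R : R) != 0.
  by rewrite subr_eq0 eqr_nat; case: (k) k_lt3 => [|[|[|]]].
pose w := weight_coords k.
(* The subtracted vector has the same inner products with the roots as omega, which makes [e]
   orthogonal to all of them. *)
have [e eE] : exists e, e = center + omega - (t / (5%:R - k%:R)) *: lin w by eexists.
have lin_w i : dot (lin w) (alpha i) = if val i == k.+2 then 5%:R - k%:R else 0.
  rewrite dot_lin (wt _ (ltn_ord i)).
  by case: ifP => // _; rewrite rmorphB.
have e_alpha i : dot e (alpha i) = 0.
  rewrite eE !dot_linE center_alpha omegaE lin_w.
  by case: ifP => _; [rewrite divfK// add0r subrr|rewrite mulr0 subr0 addr0].
have e_lin c : dot e (lin c) = 0.
  by rewrite /lin dot_sumr big1// => i _; rewrite dotZr e_alpha mulr0.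
have omega_e : center + omega = e + (t / (5%:R - k%:R)) *: lin w.
  by rewrite eE subrK.
exists e; split.
  move=> _ /orbit_pt[c _ ->].
  by rewrite /pt addrA omega_e -addrA !dotDr dotNr !dotZr !e_lin; ring.
have ww : dot (lin w) (lin w) = (6%:R - k%:R) * (5%:R - k%:R).
  have k2 : (k.+2 < k.+4)%N by [].
  rewrite {2}/lin dot_sumr (bigD1 (Ordinal k2))// big1; last first.
    by move=> i ik; rewrite dotZr lin_w ifN ?mulr0//.
  have wk' : w`_(Ordinal k2) = 6 - k%:Z by exact: wk.
  by rewrite dotZr lin_w eqxx wk' rmorphB; exact: addr0.
have := unit _ (refl_orbit_base _ _); rewrite omega_e.
rewrite !dot_linE (dotC _ e) !e_lin ww => h.
have -> : dot e e = 1 - t / (5%:R - k%:R) *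
    (t / (5%:R - k%:R) * ((6%:R - k%:R) * (5%:R - k%:R))).
  by lra.
by field.
Qed.

End GossetOrbit.

(** * Facets of the contact polytope *)

(** The product of the two Cartan integers of a pair of roots is four times the squared cosine of
    their angle. *)
Lemma kissing_dot (R : realType) (n : nat) (Phi : set 'rV[R]_n) x y :
  root_system Phi ->
  kissing_configuration Phi x -> kissing_configuration Phi y ->
  dot x x = 1 /\ 4 * dot x y ^+ 2 \is a Num.int.
Proof.
move=> rPhi [r Pr <-] [s Ps <-].
have sq z : euclid_norm z ^+ 2 = dot z z by rewrite sqr_sqrtr// dot_ge0.
have r0 := dot_gt0 (root_nonzero rPhi Pr).
have s0 := dot_gt0 (root_nonzero rPhi Ps).
have nz z : 0 < dot z z -> euclid_norm z != 0.
  by move=> z0; rewrite gt_eqF// sqrtr_gt0.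
split; rewrite !dot_linE.
  by rewrite -sq; field; exact: nz.
have -> : 4 * ((euclid_norm r)^-1 * ((euclid_norm s)^-1 * dot r s)) ^+ 2 =
    (2 * dot s r / dot r r) * (2 * dot r s / dot s s).
  by rewrite (dotC s r) -!sq; field; rewrite !nz.
by rewrite rpredM// (root_integral rPhi).
Qed.

(** Both integers are below 4. Eliminating the square of [s] from their definitions expresses [s]
    rationally in them and leaves one equation between [N] and [M], whose only solution in range is
    N = 1, M = 0. *)
Lemma edge_length (R : realType) (s : R) : 0 < s -> s < 1 ->
  4 * (1 - s) ^+ 2 \is a Num.int -> 4 * (1 - 2 * s) ^+ 2 \is a Num.int ->
  s = 1 / 2.
Proof.
move=> s0 s1 hp hq.
have /natrP[N NE] : 4 * (1 - s) ^+ 2 \is a Num.nat.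
  by rewrite natrEint hp/= mulr_ge0// sqr_ge0.
have /natrP[M ME] : 4 * (1 - 2 * s) ^+ 2 \is a Num.nat.
  by rewrite natrEint hq/= mulr_ge0// sqr_ge0.
have N4 : (N < 4)%N by rewrite -(ltr_nat R) -NE; nra.
have M4 : (M < 4)%N by rewrite -(ltr_nat R) -ME; nra.
have sE : s = 1 - (4 * N%:R + 4 - M%:R) / 16 by rewrite -NE -ME; lra.
have h : (4 * N%:R + 4 - M%:R) ^+ 2 = 64 * N%:R :> R.
  by rewrite -NE -ME; ring.
move: N M N4 M4 sE h s0 s1 {NE ME} => [|[|[|[|//]]]] [|[|[|[|//]]]] _ _ -> h s0 s1;
  lra.
Qed.

(** The direction space of aff A lies in the orthogonal complement of [e] and has the same rank, so
    the two coincide. *)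
Lemma aff_hull_diff (R : realType) (n : nat) (A : set 'rV[R]_n) e c :
  e != 0 -> has_dim A n.-1 -> A `<=` [set x | dot e x = c] ->
  forall z, dot e z = 0 ->
  exists x y, [/\ aff_hull A x, aff_hull A y & z = x - y].
Proof.
move=> e0 [p [B [Bfree AE]]] Ac z ez.
have Ap s : aff_hull A (p + s *m B) by rewrite AE; exists s.
have eA x : aff_hull A x -> dot e x = c by exact: aff_hull_hyperplane.
have mul_dot (x y : 'rV[R]_n) : x *m y^T = (dot x y)%:M by exact: mx11_scalar.
have BK : (B <= kermx e^T)%MS.
  apply/sub_kermxP/row_matrixP => i; rewrite row_mul row0 mul_dot.
  have := eA _ (Ap (delta_mx 0 i)); have := eA _ (Ap 0).
  rewrite -rowE mul0mx addr0 dotDr => ->; rewrite dotC => h.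
  by rewrite (_ : dot _ _ = 0) ?raddf0//; lra.
have KB : (kermx e^T <= B)%MS.
  rewrite -(geq_leqif (mxrank_leqif_sup BK)) mxrank_ker mxrank_tr rank_rV e0.
  by rewrite (eqP Bfree) subn1.
have /submxP[s zE] : (z <= B)%MS.
  by apply: submx_trans KB; apply/sub_kermxP; rewrite mul_dot dotC ez raddf0.
exists (p + s *m B), (p + 0 *m B); split=> //.
by rewrite mul0mx addr0 zE addrC addKr.
Qed.

Lemma span_differences (R : realType) (n : nat) (X : set 'rV[R]_n) e c x0 :
  e != 0 -> has_dim (conv_hull X) n.-1 -> X `<=` [set x | dot e x = c] -> X x0 ->
  forall S : set 'rV[R]_n,
  (forall x y, S x -> S y -> S (x + y)) -> (forall t x, S x -> S (t *: x)) ->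
  (forall x y, X x -> X y -> S (x - y)) -> forall z, dot e z = 0 -> S z.
Proof.
move=> e0 Xdim Xc Xx0 S SD SZ SX z ez.
have Fc : conv_hull X `<=` [set x | dot e x = c].
  by apply: conv_hull_min => //; exact: convex_hyperplane.
have SF x : conv_hull X x -> S (x - x0).
  suff h : conv_hull X `<=` [set x | S (x - x0)] by move=> /h.
  apply: conv_hull_min => [|y Xy]; last exact: SX.
  apply/convexP => y w t Sy Sw _ _ /=.
  have -> : t *: y + (1 - t) *: w - x0 = t *: (y - x0) + (1 - t) *: (w - x0).
    by apply/rowP => i; rewrite !mxE; ring.
  by apply: SD; exact: SZ.
have S0 : S 0 by rewrite -(scale0r (x0 - x0)); apply: SZ; exact: SX.
have SA x : aff_hull (conv_hull X) x -> S (x - x0).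
  move=> [m [p [a [Fp a1 ->]]]].
  have -> : \sum_i a i *: p i - x0 = \sum_i a i *: (p i - x0).
    rewrite -[in LHS](scale1r x0) -a1 scaler_suml -sumrB.
    by apply: eq_bigr => i _; rewrite scalerBr.
  by apply: (big_ind S) => // i _; apply: SZ; exact: SF.
have [x [y [Ax Ay ->]]] := aff_hull_diff e0 Xdim Fc ez.
have -> : x - y = (x - x0) + (-1) *: (y - x0).
  by apply/rowP => i; rewrite !mxE; ring.
by apply: SD; [|apply: SZ]; exact: SA.
Qed.

(** On a sphere about 0 the functional of [y] is largest at [y] alone, as the squared norm of
    [x - y] is positive elsewhere. *)
Lemma sphere_extreme (R : realType) (n : nat) (Y : set 'rV[R]_n) c r y :
  (forall x, Y x -> dot x x = r) -> Y y ->
  extreme (conv_hull [set c + x | x in Y]) (c + y).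
Proof.
move=> Yr Yy; apply: vertex_extreme; first exact: conv_hull_convex.
have hull : [set c + y] `<=` conv_hull [set c + x | x in Y].
  by move=> _ ->; apply: sub_conv_hull; exists y.
apply: (@face_conv_hull _ _ _ _ y (dot y (c + y))) => //; first exact: convex_set1.
  by move=> _ ->.
move=> _ [x Yx <-]; have [->|xy] := eqVneq x y; [by left|right].
rewrite -subr_eq0 in xy; have := dot_gt0 xy.
by rewrite !dot_linE (Yr _ Yx) (Yr _ Yy) (dotC x y); lra.
Qed.

Theorem corollary7 (R : realType) (n : nat) (hn : (5 <= n <= 7)%N)
  (Phi : set 'rV[R]_n) (hPhi : root_system_E Phi)
  (F : set 'rV[R]_n) (hF : facet (contact_polytope Phi) F)
  (hk : gosset_k21 (n - 5) F)
  (v : 'rV[R]_n) (hv : vertex F v) :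
  (exists beta : R,
     [/\ 0 <= beta < pi / 2,
         split_folds F v (2 * beta)
       & sin beta = 1 / (10%:R - n%:R)]) /\
  ((exists v', reflex_ridge F v v') /\
   (forall v', reflex_ridge F v v' -> dot v v' = 1 / (10%:R - n%:R))).
Proof.
have [k k3 nE] : exists2 k, (k < 3)%N & n = (k + 5)%N.
  by exists (n - 5)%N; move: hn => /andP[]; lia.
have kE : (n - 5)%N = k by rewrite nE addnK.
rewrite kE in hk; have [[fF dimF] [rPhi _]] := (hF, hPhi).
have [alpha [omega [center [alphaE omega0 omega1 FE]]]] := hk.
have k24 : (k.+2 < k.+4)%N by [].
pose t := dot omega (alpha (Ordinal k24)).
have t0 : 0 < t by exact: omega1.
have omegaE i : dot omega (alpha i) = if val i == k.+2 then t else 0.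
  case: ifPn => [/eqP ik|/omega0//].
  by rewrite /t; congr (dot _ (alpha _)); exact: val_inj.
pose orbit := refl_orbit alpha omega; pose X := [set center + x | x in orbit].
have norm_orbit x : orbit x -> dot x x = dot omega omega by exact: orbit_norm.
(* Extreme points of a facet are extreme in the polytope, hence normalized roots. *)
have kiss x : orbit x -> kissing_configuration Phi (center + x).
  move=> ox; have := sphere_extreme center norm_orbit ox; rewrite -/X -FE.
  move=> /(extreme_face (@conv_hull_convex _ _ _) fF).
  exact: extreme_conv_hull.
have unit x : orbit x -> dot (center + x) (center + x) = 1.
  by move=> /kiss Kx; have [] := kissing_dot rPhi Kx Kx.
have dotX x y : orbit x -> orbit y ->
    dot (center + x) (center + y) = 1 - dot (x - y) (x - y) / 2.
  move=> ox oy; have := unit _ ox; have := unit _ oy.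
  by rewrite !dot_linE !(dotC _ center) (dotC y x); lra.
have [x0 ox0 vE] : X v.
  apply: extreme_conv_hull; rewrite -FE; apply: vertex_extreme hv.
  by rewrite FE; exact: conv_hull_convex.
have dist := orbit_dist k3 alphaE omegaE.
have [y0 oy0 xy0] := orbit_far k3 alphaE omegaE ox0.
have t2 : 0 < t ^+ 2 by rewrite exprn_gt0.
have [g og xg] : exists2 g, orbit g & dot (x0 - g) (x0 - g) = 2 * t ^+ 2.
  case: (dist _ _ ox0 oy0) => [xyE|d2|[_ [g [h [og _ xg _ _]]]]]; last by exists g.
    by move: xy0; rewrite xyE subrr dot0l; lra.
  by move: xy0; rewrite d2; lra.
have [e [eX ee]] := orbit_axis k3 alphaE omegaE t0 unit.
have k2 : k%:R <= 2 :> R by rewrite ler_nat -ltnS.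
have t1 : t ^+ 2 < 1.
  have e0 := dot_ge0 e.
  have : 1 < (6%:R - k%:R) / (5%:R - k%:R) :> R.
    by rewrite ltr_pdivlMr; lra.
  by rewrite ee in e0; nra.
(* The inner products are 1 - t^2 along an edge and 1 - 2 t^2 along a diagonal of a square, and both
   pairs consist of normalized roots. *)
have t2E : t ^+ 2 = 1 / 2.
  apply: edge_length => //.
    have [_] := kissing_dot rPhi (kiss _ ox0) (kiss _ og).
    by rewrite dotX// xg; congr (4 * _ ^+ 2 \is a Num.int); field.
  have [_] := kissing_dot rPhi (kiss _ ox0) (kiss _ oy0).
  by rewrite dotX// xy0; congr (4 * _ ^+ 2 \is a Num.int); field.
rewrite t2E in t0 t1 t2 ee xg xy0 dist.
pose kappa : R := 1 / (10%:R - n%:R).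
have kappaE : kappa = 1 / (5%:R - k%:R).
  by rewrite /kappa nE natrD; congr (_ / _); ring.
have kappa0 : 0 < kappa by rewrite kappaE divr_gt0//; lra.
have kappa1 : kappa < 1 by rewrite kappaE ltr_pdivrMr; lra.
(* Here (6 - k)/(5 - k) is 1 + kappa. *)
have eek : dot e e = (1 - kappa) / 2.
  by rewrite ee kappaE; field; rewrite gt_eqF//; lra.
have X_unit x : X x -> dot x x = 1 by move=> [y oy <-]; exact: unit.
have X_dot x y : X x -> X y -> [\/ x = y, dot x y = 1 / 2 | dot x y = 0].
  move=> [x' ox <-] [y' oy <-]; rewrite dotX//.
  case: (dist _ _ ox oy) => [->|->|[-> _]]; [by constructor 1| |].
    by constructor 2; field.
  by constructor 3; field.
have X_square x y : X x -> X y -> dot x y = 0 -> exists g h,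
    [/\ X g, X h, dot x g = 1 / 2, dot x h = 1 / 2 & g + h = x + y].
  move=> [x' ox <-] [y' oy <-]; rewrite dotX//.
  case: (dist _ _ ox oy) => [->|->|[_ [g' [h' [og' oh' xg' xh' gh]]]]] xy.
  - by move: xy; rewrite subrr dot0l; lra.
  - by exfalso; move: xy; lra.
  exists (center + g'), (center + h'); split; [by exists g'|by exists h'| | |].
  - by rewrite dotX// xg'; field.
  - by rewrite dotX// xh'; field.
  - by rewrite addrACA gh addrACA.
have X_e x : X x -> dot e x = (1 - kappa) / 2 by move=> [y oy <-]; rewrite eX.
have Xv : X v by exists x0.
have Xy0 : X (center + y0) by exists y0.
have vy0 : dot v (center + y0) = 0 by rewrite -vE dotX// xy0; field.
have e0 : e != 0.
  by apply/eqP => e0; move: eek; rewrite e0 dot0l; lra.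
have XS : forall S : set 'rV[R]_n,
    (forall x y, S x -> S y -> S (x + y)) -> (forall t x, S x -> S (t *: x)) ->
    (forall x y, X x -> X y -> S (x - y)) -> forall z, dot e z = 0 -> S z.
  apply: (@span_differences _ _ X e ((1 - kappa) / 2) v) => //.
  by rewrite -FE.
rewrite -/kappa FE -/X; split; last split.
- have kI : -1 <= kappa < 1 by rewrite kappa1 andbT; lra.
  exists (asin kappa).
  have sk : sin (asin kappa) = kappa by rewrite asinK// in_itv/= !ltW//; lra.
  have bI : 0 <= asin kappa < pi / 2.
    rewrite asin_ltpi2// andbT leNgt; apply/negP => neg.
    (* A negative arcsine would make this sine nonnegative, while it equals [- kappa]. *)
    have : 0 <= sin (- asin kappa).
      have := @asin_geNpi2 _ kappa; rewrite (ltW kappa1) andbT => /(_ _) asin_ge.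
      have pi0 := pi_ge0 R.
      by apply: sin_ge0_pi; rewrite oppr_ge0 ltW//=; have := asin_ge _; lra.
    by rewrite sinN sk; lra.
  split=> //; apply: (split_foldsP kappa0 kappa1 X_unit X_dot X_square eek X_e
    XS Xv Xy0 vy0 erefl sk bI).
- exists (refl (e - (1 - kappa) *: v) v).
  by apply/(reflex_ridgeP kappa0 kappa1 X_unit X_dot X_square eek X_e XS Xv Xy0
    vy0 erefl).
- exact: (dot_reflex_ridge kappa0 kappa1 X_unit X_dot X_square eek X_e XS Xv Xy0
    vy0 erefl).
Qed.
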